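(* Suppose Assumptions A and B (stated in the context) hold. Then: (i) $(\tilde x_1,\tilde y_1)$ is a global minimax point of (TS) if and only if $(\tilde x_1,\tilde{\mathbf x}_2,\tilde y_1,\tilde{\mathbf y}_2)$ is a global minimax point of (INT), where $(\tilde{\mathbf x}_2(\xi),\tilde{\mathbf y}_2(\xi))$ is the unique saddle point of the second-stage minimax problem with $(\tilde x_1,\tilde y_1)$ for a.e. $\xi\in\Xi$. (ii) $(\tilde x_1,\tilde y_1)$ is a local minimax point of (TS) if and only if $(\tilde x_1,\tilde{\mathbf x}_2,\tilde y_1,\tilde{\mathbf y}_2)$ is a local minimax point of (INT), where $(\tilde{\mathbf x}_2(\xi),\tilde{\mathbf y}_2(\xi))$ is the unique saddle point of the second-stage minimax problem with $(\tilde x_1,\tilde y_1)$ for a.e. $\xi\in\Xi$.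
   Context: Setting. $\xi:\Omega\to\Xi\subset\mathbb R^l$ is a random vector on a probability space $(\Omega,\mathcal F,P)$ with support $\Xi$; $\mathbb E$ is expectation. $X_1\subset\mathbb R^{n_1}$, $Y_1\subset\mathbb R^{m_1}$ are convex compact sets. $F_1(x_1,y_1)=f(x_1)+\psi_1(x_1,y_1)-g(y_1)$, where $f:\mathbb R^{n_1}\to\mathbb R$ and $g:\mathbb R^{m_1}\to\mathbb R$ are proper lower semicontinuous, $\psi_1$ is continuously differentiable with Lipschitz gradient on $\mathbb R^{n_1}\times\mathbb R^{m_1}$, and for every $x_1\in X_1$, $g(\cdot)-\psi_1(x_1,\cdot)$ is $\sigma$-strongly convex, $\sigma>0$. $F_2:\mathbb R^{n_2}\times\mathbb R^{m_2}\times\mathbb R^l\to\mathbb R$ is such that for a.e. $\xi\in\Xi$, $F_2(\cdot,\cdot,\xi)$ is $\sigma$-strongly convex-strongly concave. For $\xi\in\Xi$: $T(\xi)\in\mathbb R^{l_2\times n_1}$, $W(\xi)\in\mathbb R^{l_2\times n_2}$, $A(\xi)\in\mathbb R^{s_2\times m_1}$, $B(\xi)\in\mathbb R^{s_2\times m_2}$, $h(\xi)\in\mathbb R^{l_2}$, $c(\xi)\in\mathbb R^{s_2}$, and $$X_2(x_1,\xi)=\{x_2:T(\xi)x_1+W(\xi)x_2\le h(\xi)\},\quad Y_2(y_1,\xi)=\{y_2:A(\xi)y_1+B(\xi)y_2\le c(\xi)\}.$$ Second-stage minimax problem: $\psi_2(x_1,y_1,\xi)=\min_{x_2\in X_2(x_1,\xi)}\max_{y_2\in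 Y_2(y_1,\xi)}F_2(x_2,y_2,\xi)$; a saddle point of it is $(x_2^*,y_2^* )\in X_2(x_1,\xi)\times Y_2(y_1,\xi)$ with $F_2(x_2^*,y_2,\xi)\le F_2(x_2^*,y_2^*,\xi)\le F_2(x_2,y_2^*,\xi)$ for all feasible $x_2,y_2$ (it exists and is unique under Assumptions A and B). Problem (TS): $\min_{x_1\in X_1}\max_{y_1\in Y_1}\psi(x_1,y_1):=F_1(x_1,y_1)+\mathbb E[\psi_2(x_1,y_1,\xi)]$. Problem (INT): $\min_{(x_1,\mathbf x_2)\in\mathbf X}\max_{(y_1,\mathbf y_2)\in\mathbf Y}\Theta$, $\Theta(x_1,\mathbf x_2,y_1,\mathbf y_2):=F_1(x_1,y_1)+\mathbb E[F_2(\mathbf x_2(\xi),\mathbf y_2(\xi),\xi)]$, with $$\mathbf X=\{(x_1,\mathbf x_2)\in\mathbb R^{n_1}\times\mathcal L_p^{n_2}:x_1\in X_1,\ T(\xi)x_1+W(\xi)\mathbf x_2(\xi)\le h(\xi)\text{ a.e. }\xi\in\Xi\},$$ $$\mathbf Y=\{(y_1,\mathbf y_2)\in\mathbb R^{m_1}\times\mathcal L_p^{m_2}:y_1\in Y_1,\ A(\xi)y_1+B(\xi)\mathbf y_2(\xi)\le c(\xi)\text{ a.e. }\xi\in\Xi\}.$$ Here $p\ge1$ and $\mathcal L_p^n$ is the Lebesgue space of measurable $\mathbb R^n$-valued functions of $\xi$ with finite $L^p$-norm $\|\cdot\|_p$. Assumption A. For every $(x_1,y_1)\in X_1\times Y_1$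 and $\xi\in\Xi$: (i) $F_2$ is continuous, $F_2(\cdot,\cdot,\xi)$ is continuously differentiable with Lipschitz gradient, and $\nabla_{x_2}F_2$, $\nabla_{y_2}F_2$ are Lipschitz continuous; (ii) $X_2(x_1,\xi)$ and $Y_2(y_1,\xi)$ are nonempty; (iii) $B(\xi)$ and $W(\xi)$ have full row rank. Assumption B. The support $\Xi$ of $\xi$ is compact, and $A(\cdot),B(\cdot),T(\cdot),W(\cdot),c(\cdot),h(\cdot)$ are continuous. Minimax points. $(\bar x_1,\bar y_1)\in X_1\times Y_1$ is a global minimax point of (TS) if $\psi(\bar x_1,y_1)\le\psi(\bar x_1,\bar y_1)\le\max_{y_1'\in Y_1}\psi(x_1,y_1')$ for all $(x_1,y_1)\in X_1\times Y_1$; it is a local minimax point if there is $\delta_0>0$ such that for any $\delta\in(0,\delta_0]$ these inequalities hold for all $(x_1,y_1)\in X_1\times Y_1$ with $\|x_1-\bar x_1\|\le\delta$, $\|y_1-\bar y_1\|\le\delta$. $(\tilde x_1,\tilde{\mathbf x}_2,\tilde y_1,\tilde{\mathbf y}_2)\in\mathbf X\times\mathbf Y$ (meaning $(\tilde x_1,\tilde{\mathbf x}_2)\in\mathbf X$, $(\tilde y_1,\tilde{\mathbf y}_2)\in\mathbf Y$) is a global minimax point of (INT) if $$\Theta(\tilde x_1,\tilde{\mathbf x}_2,y_1,\mathbf y_2)\le\Theta(\tilde x_1,\tilde{\mathbf x}_2,\tilde y_1,\tilde{\mathbf y}_2)\le\max_{(y_1',\mathbf y_2')\in\mathbf Y}\Theta(x_1,\mathbf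 x_2,y_1',\mathbf y_2')$$ for all $(x_1,\mathbf x_2)\in\mathbf X$, $(y_1,\mathbf y_2)\in\mathbf Y$; it is a local minimax point if there is $\delta_0>0$ such that for any $\delta\in(0,\delta_0]$ these inequalities hold for all such points with $\|x_1-\tilde x_1\|+\|\mathbf x_2-\tilde{\mathbf x}_2\|_p\le\delta$ and $\|y_1-\tilde y_1\|+\|\mathbf y_2-\tilde{\mathbf y}_2\|_p\le\delta$. *)

(* Defs.v *)
From HB Require Import structures.
From mathcomp Require Export all_boot all_order all_algebra.
From mathcomp Require Export all_classical all_reals all_analysis.
Export Order.TTheory GRing.Theory Num.Theory.
Export numFieldNormedType.Exports.

Set Implicit Arguments.
Unset Strict Implicit.
Unset Printing Implicit Defensive.

Local Open Scope classical_set_scope.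
Local Open Scope ring_scope.

Section euclidean_space.
Variable R : realType.

(* The library norm `|x| of a matrix is the max norm. *)
Definition enorm n (x : 'cV[R]_n) : R := Num.sqrt (\sum_i x i 0 ^+ 2).

Definition lev n (u v : 'cV[R]_n) : Prop := forall i, u i 0 <= v i 0.

Definition borelV n := g_sigma_algebraType (@open 'cV[R]_n).

Definition support n (mu : set (borelV n) -> \bar R) : set 'cV[R]_n :=
  [set z | forall U : set 'cV[R]_n, open U -> U z -> (0 < mu U)%E].

Definition strongly_convex n (s : R) (phi : 'cV[R]_n -> R) : Prop :=
  forall (x y : 'cV[R]_n) (t : R), 0 <= t <= 1 ->
    phi (t *: x + (1 - t) *: y) <=
    t * phi x + (1 - t) * phi y - s / 2 * t * (1 - t) * enorm (x - y) ^+ 2.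

Definition strongly_convex_concave n m (s : R)
    (phi : 'cV[R]_n -> 'cV[R]_m -> R) : Prop :=
  (forall y, strongly_convex s (phi ^~ y)) /\
  (forall x, strongly_convex s (fun y => - phi x y)).

Definition grad n (phi : 'cV[R]_n -> R) (x : 'cV[R]_n) : 'cV[R]_n :=
  \col_i 'D_(delta_mx i 0) phi x.

(* [lipschitz] uses the max norms; the existence of a Lipschitz constant does
   not depend on the choice of the norms. *)
Definition C1_lipschitz_grad n (phi : 'cV[R]_n -> R) : Prop :=
  [/\ forall x, differentiable phi x, continuous (grad phi)
    & lipschitz (grad phi)].

(* A function of two vectors as a function of the stacked vector. *)
Definition stacked n m (phi : 'cV[R]_n -> 'cV[R]_m -> R) (z : 'cV[R]_(n + m)) :
  R := phi (usubmx z) (dsubmx z).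

(* Functions rather than classes modulo a.e. equality: the problems below only
   depend on the classes. *)
Definition Lp_space l n (mu : {measure set (borelV l) -> \bar R}) (p : R) :
    set ('cV[R]_l -> 'cV[R]_n) :=
  [set u | measurable_fun [set: borelV l] (u : borelV l -> borelV n) /\
           ('N[mu]_(p%:E) [(fun z => (enorm (u z))%:E)] < +oo)%E].

Definition Lp_dist l n (mu : {measure set (borelV l) -> \bar R}) (p : R)
    (u v : 'cV[R]_l -> 'cV[R]_n) : \bar R :=
  'N[mu]_(p%:E) [(fun z => (enorm (u z - v z))%:E)]%E.

End euclidean_space.

Section minimax_points.
Variables (R : realType) (U V : Type).
Variables (X : set U) (Y : set V) (theta : U -> V -> \bar R).

(* The maximum over [Y] in the right-hand inequality is rendered by the
   supremum in the extended reals. *)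
Definition minimax_ineqs (a : U) (b : V) (x : U) (y : V) : Prop :=
  (theta a y <= theta a b)%E /\
  (theta a b <= ereal_sup [set theta x y' | y' in Y])%E.

Definition global_minimax_point (a : U) (b : V) : Prop :=
  [/\ X a, Y b & forall x y, X x -> Y y -> minimax_ineqs a b x y].

Definition local_minimax_point (dU : U -> U -> \bar R) (dV : V -> V -> \bar R)
    (a : U) (b : V) : Prop :=
  [/\ X a, Y b &
    exists2 delta0 : R, 0 < delta0 &
      forall delta : R, 0 < delta <= delta0 ->
        forall x y, X x -> Y y -> (dU x a <= delta%:E)%E ->
          (dV y b <= delta%:E)%E -> minimax_ineqs a b x y].

End minimax_points.

Record two_stage_data (R : realType) (n1 m1 n2 m2 l l2 s2 : nat) :=
  TwoStageData {
    X1 : set 'cV[R]_n1;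
    Y1 : set 'cV[R]_m1;
    f_ : 'cV[R]_n1 -> R;
    g_ : 'cV[R]_m1 -> R;
    psi1 : 'cV[R]_n1 -> 'cV[R]_m1 -> R;
    F2 : 'cV[R]_n2 -> 'cV[R]_m2 -> 'cV[R]_l -> R;
    T_ : 'cV[R]_l -> 'M[R]_(l2, n1);
    W_ : 'cV[R]_l -> 'M[R]_(l2, n2);
    h_ : 'cV[R]_l -> 'cV[R]_l2;
    A_ : 'cV[R]_l -> 'M[R]_(s2, m1);
    B_ : 'cV[R]_l -> 'M[R]_(s2, m2);
    c_ : 'cV[R]_l -> 'cV[R]_s2
  }.

Section two_stage_problem.
Variables (R : realType) (n1 m1 n2 m2 l l2 s2 : nat).
Variable D : two_stage_data R n1 m1 n2 m2 l l2 s2.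
Variables (d : measure_display) (Omega : measurableType d).
Variables (P : probability Omega R) (xi : {RV P >-> borelV R l}).

Definition law : probability (borelV R l) R := distribution P xi.

Definition Xi : set 'cV[R]_l := support law.

Definition F1 (x1 : 'cV[R]_n1) (y1 : 'cV[R]_m1) : R :=
  f_ D x1 + psi1 D x1 y1 - g_ D y1.

Definition X2 (x1 : 'cV[R]_n1) (z : 'cV[R]_l) : set 'cV[R]_n2 :=
  [set x2 | lev (T_ D z *m x1 + W_ D z *m x2) (h_ D z)].

Definition Y2 (y1 : 'cV[R]_m1) (z : 'cV[R]_l) : set 'cV[R]_m2 :=
  [set y2 | lev (A_ D z *m y1 + B_ D z *m y2) (c_ D z)].

Definition psi2 (x1 : 'cV[R]_n1) (y1 : 'cV[R]_m1) (z : 'cV[R]_l) : \bar R :=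
  ereal_inf [set ereal_sup [set (F2 D x2 y2 z)%:E | y2 in Y2 y1 z]
            | x2 in X2 x1 z].

Definition saddle_point (x1 : 'cV[R]_n1) (y1 : 'cV[R]_m1) (z : 'cV[R]_l)
    (x2 : 'cV[R]_n2) (y2 : 'cV[R]_m2) : Prop :=
  [/\ X2 x1 z x2, Y2 y1 z y2 &
    forall x2' y2', X2 x1 z x2' -> Y2 y1 z y2' ->
      F2 D x2 y2' z <= F2 D x2 y2 z <= F2 D x2' y2 z].

Definition unique_saddle_point (x1 : 'cV[R]_n1) (y1 : 'cV[R]_m1) (z : 'cV[R]_l)
    (x2 : 'cV[R]_n2) (y2 : 'cV[R]_m2) : Prop :=
  saddle_point x1 y1 z x2 y2 /\
  forall x2' y2', saddle_point x1 y1 z x2' y2' -> x2' = x2 /\ y2' = y2.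

Definition second_stage_solution (x1 : 'cV[R]_n1) (y1 : 'cV[R]_m1)
    (x2 : 'cV[R]_l -> 'cV[R]_n2) (y2 : 'cV[R]_l -> 'cV[R]_m2) : Prop :=
  [/\ measurable_fun [set: borelV R l] (x2 : borelV R l -> borelV R n2),
      measurable_fun [set: borelV R l] (y2 : borelV R l -> borelV R m2) &
      \forall z \ae law, unique_saddle_point x1 y1 z (x2 z) (y2 z)].

Definition psi (x1 : 'cV[R]_n1) (y1 : 'cV[R]_m1) : \bar R :=
  ((F1 x1 y1)%:E + \int[P]_w psi2 x1 y1 (xi w))%E.

Definition TS_global_minimax : 'cV[R]_n1 -> 'cV[R]_m1 -> Prop :=
  global_minimax_point (X1 D) (Y1 D) psi.

Definition TS_local_minimax : 'cV[R]_n1 -> 'cV[R]_m1 -> Prop :=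
  local_minimax_point (X1 D) (Y1 D) psi
    (fun x a => (enorm (x - a))%:E) (fun y b => (enorm (y - b))%:E).

Variable p : R.

Definition bX : set ('cV[R]_n1 * ('cV[R]_l -> 'cV[R]_n2)) :=
  [set x | [/\ Lp_space law p x.2, X1 D x.1 &
               \forall z \ae law, X2 x.1 z (x.2 z)]].

Definition bY : set ('cV[R]_m1 * ('cV[R]_l -> 'cV[R]_m2)) :=
  [set y | [/\ Lp_space law p y.2, Y1 D y.1 &
               \forall z \ae law, Y2 y.1 z (y.2 z)]].

(* For p < 2 the integrand need not be integrable on all of bX x bY: the
   expectation is the extended-real E[F^+] - E[F^-], with +oo - +oo = -oo. *)
Definition Theta (x : 'cV[R]_n1 * ('cV[R]_l -> 'cV[R]_n2))
    (y : 'cV[R]_m1 * ('cV[R]_l -> 'cV[R]_m2)) : \bar R :=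
  ((F1 x.1 y.1)%:E + \int[P]_w (F2 D (x.2 (xi w)) (y.2 (xi w)) (xi w))%:E)%E.

Definition INT_dist n k (u v : 'cV[R]_n * ('cV[R]_l -> 'cV[R]_k)) : \bar R :=
  ((enorm (u.1 - v.1))%:E + Lp_dist law p u.2 v.2)%E.

Definition INT_global_minimax (x : 'cV[R]_n1 * ('cV[R]_l -> 'cV[R]_n2))
    (y : 'cV[R]_m1 * ('cV[R]_l -> 'cV[R]_m2)) : Prop :=
  global_minimax_point bX bY Theta x y.

Definition INT_local_minimax (x : 'cV[R]_n1 * ('cV[R]_l -> 'cV[R]_n2))
    (y : 'cV[R]_m1 * ('cV[R]_l -> 'cV[R]_m2)) : Prop :=
  local_minimax_point bX bY Theta (@INT_dist n1 n2) (@INT_dist m1 m2) x y.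

(* [f_] and [g_] are real-valued, hence proper. *)
Definition standing_assumptions (sigma : R) : Prop :=
  (forall w, Xi (xi w)) /\
  [/\ convex_set (X1 D), compact (X1 D), convex_set (Y1 D) & compact (Y1 D)] /\
  lower_semicontinuous (EFin \o f_ D) /\
  lower_semicontinuous (EFin \o g_ D) /\
  C1_lipschitz_grad (stacked (psi1 D)) /\
  (forall x1, X1 D x1 -> strongly_convex sigma (fun y1 => g_ D y1 - psi1 D x1 y1)) /\
  (\forall z \ae law, strongly_convex_concave sigma (fun x2 y2 => F2 D x2 y2 z)).

(* The partial gradients are Lipschitz jointly in (x2, y2, z), z ranging over
   the support. *)
Definition assumptionA : Prop :=
  [/\ {within [set w : 'cV[R]_n2 * 'cV[R]_m2 * 'cV[R]_l | Xi w.2],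
        continuous (fun w => F2 D w.1.1 w.1.2 w.2)},
      forall z, Xi z -> C1_lipschitz_grad (stacked (fun x2 y2 => F2 D x2 y2 z)),
      [lipschitz grad (fun x2 => F2 D x2 w.1.2 w.2) w.1.1
        | w in [set w : 'cV[R]_n2 * 'cV[R]_m2 * 'cV[R]_l | Xi w.2]] /\
      [lipschitz grad (fun y2 => F2 D w.1.1 y2 w.2) w.1.2
        | w in [set w : 'cV[R]_n2 * 'cV[R]_m2 * 'cV[R]_l | Xi w.2]],
      forall x1 y1 z, X1 D x1 -> Y1 D y1 -> Xi z ->
        X2 x1 z !=set0 /\ Y2 y1 z !=set0
    & forall z, Xi z -> row_free (B_ D z) /\ row_free (W_ D z)].

Definition assumptionB : Prop :=
  compact Xi /\
  [/\ {within Xi, continuous (A_ D)}, {within Xi, continuous (B_ D)} &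
      {within Xi, continuous (T_ D)}] /\
  [/\ {within Xi, continuous (W_ D)}, {within Xi, continuous (c_ D)} &
      {within Xi, continuous (h_ D)}].

End two_stage_problem.

(* Main.v *)
Require Import Defs.
From mathcomp Require Import measurable_realfun ring lra.

Set Implicit Arguments.
Unset Strict Implicit.
Unset Printing Implicit Defensive.

Local Open Scope classical_set_scope.
Local Open Scope ring_scope.

(* Strong convexity-concavity in the second stage extends from almost every z to
   the whole support by continuity, so the second stage has a unique saddle point
   for all parameters (x1, y1, z) in the compact set X1 * Y1 * Xi. It depends
   continuously on them: full row rank gives a Slater direction, which makes the
   feasible polyhedra vary continuously, and strong convexity controls the
   distance between saddle points by the duality gap.

   The inequalities that compare psi with Theta at a saddle point are immediate,
   except one: if y1 is a local maximum of psi(x1, .) and x2 is the second stage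
   solution at (x1, y1), then psi(x1, y1) bounds Theta((x1, x2), .) on the whole
   of bY. This is a first order argument along the segment from y1 to a competitor,
   in the limit where the step tends to 0.

   From (INT) to (TS), the outer inequality at x1 is tested at the second stage
   solution for (x1, y1'), where y1' is the maximizer of psi(x1, .). In the local
   case, strong concavity makes y1', hence this solution, continuous in x1. *)

(** The obstacle behind the first order argument is that [psi] re-optimizes [x2] for each [y]: with
    [x2] frozen, the supremum of [Theta] over the second stage of [y] lies above [psi], so a maximum
    of [psi] does not directly bound it. What is needed is a form of Danskin's theorem. The feasible
    polyhedra may be unbounded, so extrema come from strong convexity rather than compactness. Its
    quadratic growth also bounds [F2] above, uniformly in [y2], as long as [x2] is bounded. Hence
    against a bounded [x2] any competitor has either expectation [-oo] or an integrable integrand.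
    Closeness in the L^p norm is reached through uniform closeness: the law has mass 1, so solutions
    uniformly close on the support are close for every [p]. The topology is that of the max norm,
    whereas strong convexity and the distances of the problems use [enorm]; the constants comparing
    them depend only on the dimension. *)

Section matrix_norm.
Context {R : realType}.

Lemma entry_le_normm m n (A : 'M[R]_(m, n)) i j : `|A i j| <= `|A|.
Proof. by rewrite [leRHS]mx_normrE; apply: (le_bigmax _ _ (i, j)). Qed.

Lemma normm_le m n (A : 'M[R]_(m, n)) c :
  0 <= c -> (forall i j, `|A i j| <= c) -> `|A| <= c.
Proof.
by move=> c0 H; rewrite [leLHS]mx_normrE; apply: bigmax_le => // -[i j] _; exact: H.
Qed.

Lemma entry_mulmx_le m n p (A : 'M[R]_(m, n)) (B : 'M[R]_(n, p)) i j :
  `|(A *m B) i j| <= n%:R * `|A| * `|B|.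
Proof.
rewrite mxE; apply: (le_trans (ler_norm_sum _ _ _)).
apply: (@le_trans _ _ (\sum_(k < n) `|A| * `|B|)).
  by apply: ler_sum => k _; rewrite normrM ler_pM// entry_le_normm.
by rewrite sumr_const card_ord -[leLHS]mulr_natl mulrA.
Qed.

Lemma normm_tr m n (A : 'M[R]_(m, n)) : `|A^T| = `|A|.
Proof.
apply/eqP; rewrite eq_le; apply/andP; split; apply: normm_le => // i j.
  by rewrite mxE entry_le_normm.
by rewrite -[A]trmxK mxE trmxK entry_le_normm.
Qed.

End matrix_norm.

Section euclidean_norm.
Context {R : realType}.
Implicit Types n : nat.

Lemma enorm_ge0 n (x : 'cV[R]_n) : 0 <= enorm x.
Proof. exact: sqrtr_ge0. Qed.

Lemma enorm_sqr n (x : 'cV[R]_n) : enorm x ^+ 2 = \sum_i x i 0 ^+ 2.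
Proof. by rewrite sqr_sqrtr// sumr_ge0// => i _; exact: sqr_ge0. Qed.

Lemma enormZ n a (x : 'cV[R]_n) : enorm (a *: x) = `|a| * enorm x.
Proof.
rewrite /enorm; under eq_bigr do rewrite mxE exprMn.
by rewrite -mulr_sumr sqrtrM ?sqr_ge0// sqrtr_sqr.
Qed.

Lemma enorm_distC n (x y : 'cV[R]_n) : enorm (x - y) = enorm (y - x).
Proof. by rewrite -opprB -scaleN1r enormZ normrN1 mul1r. Qed.

Lemma enorm0 n : enorm (0 : 'cV[R]_n) = 0.
Proof. by rewrite -(scale0r 0) enormZ normr0 mul0r. Qed.

Lemma normm_le_enorm n (x : 'cV[R]_n) : `|x| <= enorm x.
Proof.
rewrite [leLHS]mx_normrE; apply: bigmax_le; first exact: enorm_ge0.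
move=> [i j] _ /=; rewrite (ord1 j) -sqrtr_sqr ler_wsqrtr//.
by rewrite (bigD1 i)//= lerDl sumr_ge0// => k _; exact: sqr_ge0.
Qed.

Lemma enorm_le_normm n (x : 'cV[R]_n) : enorm x <= n%:R * `|x|.
Proof.
rewrite -(ger0_norm (enorm_ge0 x)) -(@ger0_norm _ (n%:R * `|x|)) ?mulr_ge0//.
rewrite -ler_sqr ?nnegrE ?normr_ge0// !real_normK ?num_real// enorm_sqr.
apply: (@le_trans _ _ (\sum_(i < n) `|x| ^+ 2)).
  apply: ler_sum => i _; rewrite -real_normK ?num_real//.
  by rewrite lerXn2r ?nnegrE//; exact: entry_le_normm.
rewrite sumr_const card_ord -[leLHS]mulr_natl exprMn ler_wpM2r ?sqr_ge0//.
by rewrite -natrX ler_nat; case: (n) => // k; rewrite leq_pmulr.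
Qed.

End euclidean_norm.

(** * Strong convexity: growth, lower bounds, minimizers *)

Section strong_convexity.
Context {R : realType}.

(** Carries out the limit of small steps in every first order argument below, without filters. *)
Lemma ler_of_linear_error (a b c : R) :
  (forall t, 0 < t < 1 -> a <= b + t * c) -> a <= b.
Proof.
move=> H; apply/ler_addgt0Pr => e e0.
pose t := Num.min (1/2) (e / (`|c| + 1)).
have c1 : 0 < `|c| + 1 by rewrite ltr_wpDl.
have t0 : 0 < t by rewrite lt_min divr_gt0//= divr_gt0.
have t1 : t < 1 by rewrite gt_min; apply/orP; left; lra.
apply: (le_trans (H t _)); first by rewrite t0.
rewrite lerD2l; apply: (@le_trans _ _ (t * (`|c| + 1))).
  rewrite ler_wpM2l ?(ltW t0)//; apply: (le_trans (ler_norm _)).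
  by rewrite lerDl.
by rewrite -ler_pdivlMr// ge_min lexx orbT.
Qed.

Definition convex_subset (V : lmodType R) (C : set V) :=
  forall x y t, 0 <= t <= 1 -> C x -> C y -> C (t *: x + (1 - t) *: y).

(** Relative to [C], because the first stage objective is only known to be strongly concave on
    [Y1]. *)
Definition strongly_convex_on n s (C : set 'cV[R]_n) (phi : 'cV[R]_n -> R) :=
  forall (x y : 'cV[R]_n) t, C x -> C y -> 0 <= t <= 1 ->
    phi (t *: x + (1 - t) *: y) <=
    t * phi x + (1 - t) * phi y - s / 2 * t * (1 - t) * enorm (x - y) ^+ 2.

Variables (n : nat) (s : R) (C : set 'cV[R]_n) (phi : 'cV[R]_n -> R).
Hypotheses (s_gt0 : 0 < s) (cvxC : convex_subset C).
Hypothesis scphi : strongly_convex_on s C phi.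

(** Compare [x0] with [t *: x + (1 - t) *: x0], divide by [t] and let [t] tend to 0: the quadratic
    term survives. *)
Lemma strongly_convex_growth x0 : C x0 -> (forall x, C x -> phi x0 <= phi x) ->
  forall x, C x -> phi x0 + s / 2 * enorm (x - x0) ^+ 2 <= phi x.
Proof.
move=> Cx0 min_x0 x Cx; set e := enorm _ ^+ 2.
apply: (@ler_of_linear_error _ _ (s / 2 * e)) => t /andP[t0 t1].
have t01 : 0 <= t <= 1 by rewrite !ltW.
have := scphi Cx Cx0 t01; have := min_x0 _ (cvxC t01 Cx Cx0).
rewrite -/e; set q := phi (_ + _) => h1 h2.
have : 0 <= t * (phi x - phi x0 - s / 2 * (1 - t) * e) by lra.
by rewrite pmulr_rge0//; lra.
Qed.

Hypothesis closed_sublevel : forall c, closed [set x | C x /\ phi x <= c].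

(** Lower semicontinuity bounds [phi] near [x0]. A far point [x] is compared with the point of its
    segment to [x0] at distance [h]: strong convexity gives a gain [s / 2 * r ^+ 2] against a loss
    [k * r], and completing the square yields the bound. *)
Lemma strongly_convex_bounded_below x0 : C x0 ->
  exists m, forall x, C x -> m <= phi x.
Proof.
move=> Cx0; have [e /= e0 He] : nbhs_ball x0 [set x | C x -> phi x0 - 1 < phi x].
  rewrite nbhs_ballE.
  have := closed_openC (@closed_sublevel (phi x0 - 1)).
  rewrite openE => /(_ x0); have H : (~` [set x | C x /\ phi x <= phi x0 - 1]) x0.
    by move=> /= [_]; lra.
  move=> /(_ H); apply: filterS => x /= nx Cx.
  by rewrite ltNge; apply/negP => ?; apply: nx.
set h := e / 2; have h0 : 0 < h by rewrite divr_gt0.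
set k := h^-1 + s * h / 2.
exists (phi x0 - 1 - k ^+ 2 / (2 * s)) => x Cx.
have k2 : 0 <= k ^+ 2 / (2 * s) by rewrite divr_ge0 ?sqr_ge0// mulr_ge0// ltW.
set r := enorm (x - x0); have r0 : 0 <= r by exact: enorm_ge0.
have near_x0 y : C y -> enorm (y - x0) < e -> phi x0 - 1 < phi y.
  move=> Cy hy; apply: He => //; rewrite -ball_normE /= -normrN opprB.
  exact: (le_lt_trans (normm_le_enorm _)).
have [re|re] := ltP r e; first by have := near_x0 _ Cx re; lra.
have hr : h < r by apply: lt_le_trans re; rewrite /h; lra.
have rp : 0 < r by exact: lt_trans hr.
set t := h / r; have t0 : 0 < t by rewrite divr_gt0.
have t1 : t < 1 by rewrite ltr_pdivrMr// mul1r.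
have t01 : 0 <= t <= 1 by rewrite !ltW.
have tr : t * r = h by rewrite mulfVK// gt_eqF.
have := near_x0 _ (cvxC t01 Cx Cx0).
have -> : t *: x + (1 - t) *: x0 - x0 = t *: (x - x0).
  by rewrite scalerBl scale1r scalerBr; apply/matrixP=> i j; rewrite !mxE; ring.
rewrite enormZ gtr0_norm// -/r tr => /(_ _)/wrap[]; first by rewrite /h; lra.
have := scphi Cx Cx0 t01; set q := phi (_ + _); rewrite -/r => h1 h2.
have h3 : 0 <= t * (phi x - phi x0) + 1 - s / 2 * (1 - t) * t * r ^+ 2 by lra.
(* Multiplying by [r] turns [t * r] into [h], so that the common factor [h] can be cancelled. *)
have h4 : 0 <= r * (t * (phi x - phi x0) + 1 - s / 2 * (1 - t) * t * r ^+ 2).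
  exact: mulr_ge0.
have h5 : r * (t * (phi x - phi x0) + 1 - s / 2 * (1 - t) * t * r ^+ 2) =
  h * (phi x - phi x0 + r / h - s / 2 * (r - h) * r).
  rewrite -tr; field; apply/andP; split; exact: lt0r_neq0.
move: h4; rewrite h5 pmulr_rge0// => h6.
have h7 : 0 <= s / 2 * (r - k / s) ^+ 2 by rewrite mulr_ge0 ?sqr_ge0// divr_ge0 ?ltW.
have h8 : s / 2 * (r - k / s) ^+ 2 = s / 2 * r ^+ 2 - k * r + k ^+ 2 / (2 * s).
  by field; exact: lt0r_neq0.
have h9 : k * r = r / h + s / 2 * h * r by rewrite /k; field; exact: lt0r_neq0.
lra.
Qed.

(** A minimizing sequence is Cauchy by the midpoint inequality, so [C] need not be bounded; its
    limit lies in every sublevel set above the infimum. *)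
Lemma strongly_convex_argmin : C !=set0 ->
  exists2 x0, C x0 & forall x, C x -> phi x0 + s / 2 * enorm (x - x0) ^+ 2 <= phi x.
Proof.
move=> [c Cc]; have [m lbm] := strongly_convex_bounded_below Cc.
pose I := inf [set phi x | x in C].
have hI : has_inf [set phi x | x in C].
  by split; [exists (phi c), c|exists m => _ [x Cx <-]; exact: lbm].
have lbI x : C x -> I <= phi x by move=> Cx; apply: ge_inf; [exact: hI.2|exists x].
have /choice[u Hu] : forall k : nat, exists x, C x /\ phi x < I + k.+1%:R^-1.
  move=> k; have k0 : 0 < k.+1%:R^-1 :> R by rewrite invr_gt0.
  have [_ [x Cx <-] h] := inf_adherent k0 hI.
  by exists x.
have half01 : 0 <= (1/2 : R) <= 1 by lra.
have key j k : s / 8 * enorm (u j - u k) ^+ 2 <= (j.+1%:R^-1 + k.+1%:R^-1) / 2.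
  have [Cj hj] := Hu j; have [Ck hk] := Hu k.
  have := lbI _ (cvxC half01 Cj Ck); have := scphi Cj Ck half01.
  move: hj hk; set a := _^-1; set b := k.+1%:R^-1.
  set q := phi (_ + _); set e := enorm _ ^+ 2. lra.
have cu : cvg (u @ \oo).
  apply/cauchy_cvgP; apply: cauchy_exP => e e0.
  have [N _ HN] : \forall k \near \oo, (k.+1%:R^-1 : R) < s / 8 * e ^+ 2.
    have /cvgr0_norm_lt/(_ (s / 8 * e ^+ 2)) := @cvg_harmonic R.
    move=> /(_ _)/wrap[]; first by rewrite mulr_gt0 ?exprn_gt0// divr_gt0.
    by apply: filterS => k; rewrite /harmonic ger0_norm// invr_ge0.
  exists (u N), N => // k /= Nk; rewrite -ball_normE /=.
  apply: (le_lt_trans (normm_le_enorm _)).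
  rewrite -(@ltr_pXn2r _ 2)// ?nnegrE ?enorm_ge0 ?(ltW e0)//.
  have s8 : 0 < s / 8 by rewrite divr_gt0.
  rewrite -(ltr_pM2l s8); apply: (le_lt_trans (key _ _)).
  by have := HN _ (leqnn N); have := HN _ Nk => /=; set a := _^-1; set b := N.+1%:R^-1; lra.
have lim_sub e : 0 < e -> C (lim (u @ \oo)) /\ phi (lim (u @ \oo)) <= I + e.
  move=> e0; apply: (closed_cvg [set x | C x /\ phi x <= I + e] (F := \oo) (u_ := u)) => //.
  have /cvgr0_norm_lt/(_ e e0) := @cvg_harmonic R.
  apply: filterS => k; rewrite /harmonic ger0_norm ?invr_ge0// => hk.
  by have [Ck hk'] := Hu k; split => //; rewrite (le_trans (ltW hk'))// lerD2l ltW.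
have C0 : C (lim (u @ \oo)) by have [] := lim_sub 1 ltr01.
exists (lim (u @ \oo)) => //; apply: strongly_convex_growth => // x Cx.
apply: le_trans (lbI _ Cx); apply/ler_addgt0Pr => e e0.
by have [] := lim_sub e e0.
Qed.

End strong_convexity.

(** * Saddle points of strongly convex-concave functions *)

Section saddle.
Context {R : realType}.

Definition is_saddle n m (F : 'cV[R]_n -> 'cV[R]_m -> R) C D x y :=
  [/\ C x, D y & forall x' y', C x' -> D y' -> F x y' <= F x y <= F x' y].

Variables (n m : nat) (F : 'cV[R]_n -> 'cV[R]_m -> R) (s : R).
Variables (C : set 'cV[R]_n) (D : set 'cV[R]_m).
Hypotheses (s_gt0 : 0 < s) (scF : strongly_convex_concave s F).
Hypotheses (cvxC : convex_subset C) (cvxD : convex_subset D).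

(** Adds the quadratic growth of [F ^~ y] at its minimizer [x] to that of [- F x] at its minimizer
    [y]. *)
Lemma saddle_gap x y x' y' : is_saddle F C D x y -> C x' -> D y' ->
  s / 2 * (enorm (x' - x) ^+ 2 + enorm (y' - y) ^+ 2) <= F x' y - F x y'.
Proof.
move=> [Cx Dy sad] Cx' Dy'; have [scx scy] := scF.
have h1 : F x y + s / 2 * enorm (x' - x) ^+ 2 <= F x' y.
  apply: (@strongly_convex_growth _ _ _ C (F ^~ y)) => //.
  - by move=> ? ? ? _ _; exact: scx.
  - by move=> z Cz; have /andP[] := sad z y Cz Dy.
have h2 : - F x y + s / 2 * enorm (y' - y) ^+ 2 <= - F x y'.
  apply: (@strongly_convex_growth _ _ _ D (fun z => - F x z)) => //.
  - by move=> ? ? ? _ _; exact: scy.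
  - by move=> z Dz; rewrite lerN2; have /andP[] := sad x z Cx Dz.
lra.
Qed.

Lemma saddle_uniq x y x' y' : is_saddle F C D x y -> is_saddle F C D x' y' ->
  x' = x /\ y' = y.
Proof.
move=> sad [Cx' Dy' sad']; have := saddle_gap sad Cx' Dy'.
have [Cx Dy _] := sad; have /andP[h1 h2] := sad' _ _ Cx Dy.
have e1 := sqr_ge0 (enorm (x' - x)); have e2 := sqr_ge0 (enorm (y' - y)).
move=> h; have : enorm (x' - x) ^+ 2 + enorm (y' - y) ^+ 2 <= 0.
  have s2 : 0 < s / 2 by rewrite divr_gt0.
  by rewrite -(pmulr_rle0 _ s2); lra.
move=> h3; have z1 : enorm (x' - x) ^+ 2 = 0 by lra.
have z2 : enorm (y' - y) ^+ 2 = 0 by lra.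
have nul k (u v : 'cV[R]_k) : enorm (u - v) ^+ 2 = 0 -> u = v.
  move=> /eqP; rewrite sqrf_eq0 => /eqP h0; apply/eqP; rewrite -subr_eq0 -normr_le0.
  by rewrite -h0; exact: normm_le_enorm.
by split; exact: nul.
Qed.

Hypotheses (clC : closed C) (clD : closed D).
Hypotheses (C0 : C !=set0) (D0 : D !=set0).
Hypothesis cF1 : forall y, continuous (F ^~ y).
Hypothesis cF2 : forall x, continuous (F x).

(** Minimize [v x], the maximum of [F x] over [D], and take the maximizer [b x0] at the minimizer
    [x0]. The remaining inequality [v x0 <= F x (b x0)] follows along the segment from [x0] to [x]:
    it holds with [b] taken at the points of the segment, and these maximizers converge. *)
Lemma saddle_exists : exists x y, is_saddle F C D x y.
Proof.
have [scx scy] := scF.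
have /choice[b Hb] : forall x, exists y, D y /\
    forall y', D y' -> F x y' + s / 2 * enorm (y' - y) ^+ 2 <= F x y.
  move=> x; have [|||||y Dy h] := @strongly_convex_argmin _ _ s D (fun y => - F x y).
  - exact: s_gt0.
  - exact: cvxD.
  - by move=> ? ? ? _ _; exact: scy.
  - move=> c; apply: closedI => //.
    apply: (@preimage_closed _ _ (fun y => - F x y) [set r | r <= c]).
      by move=> y _; exact: (cvgN (@cF2 x y)).
    exact: closed_le.
  - exact: D0.
  by exists y; split => // y' Dy'; have := h _ Dy'; lra.
pose v x := F x (b x).
have le_v x y : D y -> F x y <= v x.
  move=> Dy; have [_ /(_ _ Dy)] := Hb x; apply: le_trans.
  by rewrite lerDl mulr_ge0 ?sqr_ge0// divr_ge0 ?ltW.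
have [|||||x0 Cx0 minx0] := @strongly_convex_argmin _ _ s C v.
- exact: s_gt0.
- exact: cvxC.
- move=> x y t _ _ t01; have [Db _] := Hb (t *: x + (1 - t) *: y).
  apply: (le_trans (scx _ _ _ _ t01)).
  have /andP[t0 t1] := t01; have t1' : 0 <= 1 - t by lra.
  have := ler_wpM2l t0 (le_v x _ Db); have := ler_wpM2l t1' (le_v y _ Db).
  rewrite /v; lra.
(* As an intersection of sublevel sets of the functions [F ^~ y], this set is closed without knowing
   that [v] is continuous. *)
- move=> c; have -> : [set x | C x /\ v x <= c] =
      C `&` \bigcap_(y in D) [set x | F x y <= c].
    apply/seteqP; split => x /= [Cx h]; split => //.
      by move=> y Dy /=; exact: le_trans (le_v _ _ Dy) h.
    by apply: h; have [] := Hb x.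
  apply: closedI => //; apply: closed_bigI => y Dy.
  by apply: (@preimage_closed _ _ (F ^~ y) [set r | r <= c]);
    [move=> ? _; exact: cF1|exact: closed_le].
- exact: C0.
exists x0, (b x0); have [Db0 hb0] := Hb x0; split => // x y Cx Dy.
rewrite le_v//=; set y0 := b x0.
pose p (t : R) := t *: x + (1 - t) *: x0.
have Cp (t : R) : 0 < t < 1 -> C (p t) by move=> /andP[? ?]; apply: cvxC => //; rewrite !ltW.
have vx0 : forall x', C x' -> v x0 <= v x'.
  move=> x' Cx'; apply: le_trans (minx0 _ Cx'); rewrite lerDl mulr_ge0 ?sqr_ge0//.
  by rewrite divr_ge0 ?ltW.
have Fp (t : R) : 0 < t < 1 -> v (p t) <= t * F x (b (p t)) + (1 - t) * F x0 (b (p t)).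
  move=> /andP[t0 t1]; have t01 : 0 <= t <= 1 by rewrite !ltW.
  have := scx (b (p t)) x x0 t t01; set e := enorm _ ^+ 2.
  have e0 : 0 <= e by exact: sqr_ge0.
  have : 0 <= s / 2 * t * (1 - t) * e.
    apply: mulr_ge0 => //; apply: mulr_ge0; last lra.
    by rewrite mulr_ge0 ?(ltW t0)// divr_ge0// ltW.
  rewrite /v /=; lra.
(* Combine [v x0 <= v (p t)] with the convexity bound and [F x0 (b (p t)) <= v x0], then divide by
   [t]. *)
have key (t : R) : 0 < t < 1 -> v x0 <= F x (b (p t)).
  move=> t01; have [Db _] := Hb (p t).
  have := Fp _ t01; have := vx0 _ (Cp _ t01); have := le_v x0 _ Db.
  move: t01 => /andP[t0 t1] h1 h2 h3.
  have h4 : (1 - t) * F x0 (b (p t)) <= (1 - t) * v x0 by rewrite ler_wpM2l// subr_ge0 ltW.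
  have : 0 <= t * (F x (b (p t)) - v x0) by lra.
  by rewrite pmulr_rge0//; lra.
(* the maximizers at the points of the segment tend to the one at [x0] *)
have bnd (t : R) : 0 < t < 1 -> (1 - t) * (s / 2 * enorm (b (p t) - y0) ^+ 2) <=
    (1 - t) * v x0 + t * v x - F (p t) y0.
  move=> t01; have [Db _] := Hb (p t).
  have h1 := Fp _ t01; have h2 := le_v x _ Db.
  have h3 := le_v (p t) _ Db0; have := hb0 _ Db; move: t01 => /andP[t0 t1].
  rewrite -/y0 -/(v x0); set e := enorm _ ^+ 2 => h4.
  have h5 : (1 - t) * (F x0 (b (p t)) + s / 2 * e) <= (1 - t) * v x0.
    by rewrite ler_wpM2l// subr_ge0 ltW.
  have h6 : t * F x (b (p t)) <= t * v x by rewrite ler_wpM2l// ltW.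
  rewrite /y0; lra.
rewrite -/(v x0); apply/ler_addgt0Pr => e e0.
have [d /= d0 Hd] : nbhs_ball y0 [set y | F x y < F x y0 + e].
  rewrite nbhs_ballE.
  have /cvgr_lt/(_ (F x y0 + e)) := @cF2 x y0; apply.
  by rewrite ltrDl.
have pc : p t @[t --> (0 : R)] --> x0.
  have -> : x0 = p 0 by rewrite /p scale0r add0r subr0 scale1r.
  apply: (@continuous_comp _ _ _ id p); first by [].
  rewrite /p /=; apply: cvgD; first by apply: cvgZr_tmp; exact: cvg_id.
  by apply: cvgZr_tmp; apply: cvgB; [exact: cvg_cst|exact: cvg_id].
have lim0 : ((1 - t) * v x0 + t * v x - F (p t) y0) @[t --> (0 : R)] --> (0 : R).
  have {2}-> : (0 : R) = (1 - 0) * v x0 + 0 * v x - F x0 y0 by rewrite /v -/y0; ring.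
  apply: cvgB; last exact: (cvg_comp _ _ pc (@cF1 y0 x0)).
  apply: cvgD; apply: cvgM; try exact: cvg_cst; last exact: cvg_id.
  by apply: cvgB; [exact: cvg_cst|exact: cvg_id].
have dd : 0 < s / 4 * d ^+ 2 by rewrite mulr_gt0 ?divr_gt0 ?exprn_gt0.
have /cvgr_lt/(_ _ dd)[r /= r0 Hr] := lim0.
(* The bound [t <= 1 / 2] turns the factor [(1 - t) * (s / 2)] of [bnd] into at least [s / 4]. *)
pose t := Num.min (r / 2) (1 / 2).
have t0 : 0 < t by rewrite lt_min !divr_gt0.
have t2 : t <= 1 / 2 by rewrite ge_min lexx orbT.
have t01 : 0 < t < 1 by apply/andP; split => //; lra.
have tr : ball 0 r t.
  rewrite -ball_normE /= sub0r normrN gtr0_norm//.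
  by apply: (@le_lt_trans _ _ (r / 2)); [rewrite ge_min lexx|lra].
have := Hr _ tr; have := bnd _ t01; rewrite /=; set e2 := enorm _ ^+ 2 => h1 h2.
have : s / 4 * e2 <= (1 - t) * (s / 2 * e2).
  have -> : s / 4 * e2 = (1 / 2) * (s / 2 * e2) by field.
  by rewrite ler_wpM2r ?mulr_ge0 ?enorm_ge0 ?invr_ge0 ?(ltW s_gt0)//; lra.
move=> h3; have : e2 < d ^+ 2.
  have s4 : 0 < s / 4 by rewrite divr_gt0.
  by rewrite -(ltr_pM2l s4); lra.
rewrite ltr_pXn2r ?nnegrE ?enorm_ge0 ?(ltW d0)// => h4.
have : F x (b (p t)) < F x y0 + e.
  apply: Hd; rewrite -ball_normE /= distrC.
  exact: le_lt_trans (normm_le_enorm _) h4.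
by move=> /ltW; apply: le_trans; exact: key.
Qed.

End saddle.

(** Transported by transposition from row vectors, where bounded closed sets are compact. *)
Lemma compact_normm_le {R : realType} n (M : R) : compact [set x : 'cV[R]_n | `|x| <= M].
Proof.
have -> : [set x : 'cV[R]_n | `|x| <= M] = trmx @` [set x : 'rV[R]_n | `|x| <= M].
  apply/seteqP; split => x /=.
    by move=> xM; exists x^T; rewrite ?trmxK//= normm_tr.
  by move=> [y yM <-]; rewrite normm_tr.
apply: continuous_compact.
  apply: continuous_subspaceT => x B /nbhs_ballP[e /= e0 eB]; apply/nbhs_ballP.
  exists e => // y xy; apply: eB; move: xy.
  by rewrite -!ball_normE /= -linearB normm_tr.
apply: bounded_closed_compact.
  by exists M; split; [exact: num_real|move=> N MN x /= /le_trans; apply; exact: ltW].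
apply: (@preimage_closed _ _ (fun x : 'rV[R]_n => `|x|) [set r | r <= M]).
  by move=> x _; exact: norm_continuous.
exact: closed_le.
Qed.

(** Compactness is used as the near-covering property for the filter of small positive radii: near
    each point of [K] all small radii work, hence one radius works on all of [K]. *)
Lemma heine_cantor {R : realType} {T U : pseudoMetricType R} (K : set T)
    (f : T -> U) : compact K -> {within K, continuous f} ->
  forall e : R, 0 < e -> exists2 d : R, 0 < d &
    forall a b, K a -> K b -> ball a d b -> ball (f a) e (f b).
Proof.
move=> cK /subspace_continuousP cf e e0.
pose P (d : R) x := K x -> forall b, K b -> ball x d b -> ball (f x) e (f b).
have e2 : 0 < e / 2 by rewrite divr_gt0.
have H : \forall d \near (0 : R)^'+, K `<=` P d.
  apply: (compact_near_coveringP K).1 => // x Kx.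
  have := cf x Kx (ball (f x) (e / 2)) (nbhsx_ballx _ _ e2).
  rewrite nbhs_simpl /within /= => /nbhs_ballP[r /= r0 Hr].
  have r2 : 0 < r / 2 by rewrite divr_gt0.
  exists (ball x (r / 2), [set d | d <= r / 2]).
    split; first exact: nbhsx_ballx.
    exact: nbhs_right_le.
  move=> [y d] /= [xy dr] Ky b Kb yb.
  have xb : ball x r b by apply: ball_split xy (le_ball dr yb).
  have xy' : ball x r y by apply: le_ball xy; lra.
  by apply: ball_split (Hr _ xb Kb); apply: ball_sym; exact: Hr.
have [d [d0 Hd]] : exists d : R, 0 < d /\ K `<=` P d.
  have : \forall d \near (0 : R)^'+, 0 < d /\ K `<=` P d.
    by apply: filterI => //; exact: nbhs_right_gt.
  by move=> /filter_ex.
by exists d => // a b Ka Kb; apply: (Hd a Ka Ka).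
Qed.

(** * Continuous dependence of polyhedra and saddle points on a parameter *)

Section parametric_saddle.
Context {R : realType} {T : pseudoMetricType R} (K : set T).

(** Hausdorff continuity at [t0] in both directions, tested only on points of norm at most [M],
    since the sets may be unbounded. *)
Definition locally_hausdorff_continuous n (C : T -> set 'cV[R]_n) :=
  forall t0 (M e : R), K t0 -> 0 < e -> exists2 d : R, 0 < d &
    forall t, K t -> ball t0 d t -> forall x : 'cV[R]_n, `|x| <= M ->
      (C t0 x -> exists2 x', C t x' & `|x - x'| <= e) /\
      (C t x -> exists2 x', C t0 x' & `|x - x'| <= e).

(* [w] with [W t0 *m w = 1] is a Slater direction: moving along [- w] creates
   slack in every row of the system, which absorbs the perturbation. *)
Lemma polyhedron_hausdorff_continuous k n (W : T -> 'M[R]_(k, n)) (b : T -> 'cV_k) :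
  {within K, continuous W} -> {within K, continuous b} ->
  (forall t, K t -> row_free (W t)) ->
  locally_hausdorff_continuous (fun t => [set x | lev (W t *m x) (b t)]).
Proof.
move=> /subspace_continuousP cW /subspace_continuousP cb rfW t0 M e Kt0 e0.
pose w : 'cV[R]_n := pinvmx (W t0) *m const_mx 1.
have Ww i : (W t0 *m w) i 0 = 1.
  by rewrite mulmxA mulmxVp ?rfW// mul1mx mxE.
have w1 : 0 < `|w| + 1 by rewrite ltr_wpDl.
pose s := e / (`|w| + 1); have s0 : 0 < s by rewrite divr_gt0.
have sw : `|s *: w| <= e.
  rewrite normrZ gtr0_norm// /s mulrAC ler_pdivrMr// ler_wpM2l ?(ltW e0)//; lra.
pose N := n%:R * (`|M| + e) + 1.
have N0 : 0 < N by rewrite ltr_wpDl// mulr_ge0// addr_ge0// ltW.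
(* Changing [W] within [tau] and [b] within [s / 2] costs at most [s / 2] each per row; together
   they use up the slack [s] gained along [- w]. *)
pose tau := s / (2 * N); have tau0 : 0 < tau by rewrite divr_gt0// mulr_gt0.
have tauN : tau * N = s / 2 by rewrite /tau; field; exact: lt0r_neq0.
have := cW _ Kt0 (ball (W t0) tau) (nbhsx_ballx _ _ tau0).
rewrite nbhs_simpl /within /= => /nbhs_ballP[d1 /= d10 H1].
have s2 : 0 < s / 2 by rewrite divr_gt0.
have := cb _ Kt0 (ball (b t0) (s / 2)) (nbhsx_ballx _ _ s2).
rewrite nbhs_simpl /within /= => /nbhs_ballP[d2 /= d20 H2].
exists (Num.min d1 d2); first by rewrite lt_min d10.
move=> t Kt t0t x xM.
have /H1/(_ Kt) : ball t0 d1 t by apply: le_ball t0t; rewrite ge_min lexx.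
rewrite -ball_normE /= => hW.
have /H2/(_ Kt) : ball t0 d2 t by apply: le_ball t0t; rewrite ge_min lexx orbT.
rewrite -ball_normE /= => hb.
have hWx (y : 'cV[R]_n) i : `|y| <= `|M| + e -> `|((W t0 - W t) *m y) i 0| <= s / 2.
  move=> yM; apply: (le_trans (entry_mulmx_le _ _ _ _)).
  rewrite -tauN mulrAC [leLHS]mulrC ler_pM// ?mulr_ge0 ?(ltW hW)//.
  rewrite /N; apply: ler_wpDr => //.
  by rewrite ler_wpM2l.
have hbi i : `|b t0 i 0 - b t i 0| <= s / 2.
  apply: le_trans (ltW hb); have := entry_le_normm (b t0 - b t) i 0.
  by rewrite !mxE.
have xsw : `|x - s *: w| <= `|M| + e.
  by apply: (le_trans (ler_normB _ _)); apply: lerD => //; apply: le_trans (ler_norm _).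
have xM' : `|x| <= `|M| + e.
  by apply: (le_trans xM); apply: (le_trans (ler_norm _)); rewrite lerDl ltW.
have dif (y : 'cV[R]_n) i : (W t *m y) i 0 = (W t0 *m y) i 0 - ((W t0 - W t) *m y) i 0.
  have e2 (u v : 'cV[R]_k) : (u - v) i 0 = u i 0 - v i 0 by rewrite !mxE.
  by rewrite mulmxBl e2; ring.
have W0x i : (W t0 *m (x - s *: w)) i 0 = (W t0 *m x) i 0 - s.
  have e2 (u v : 'cV[R]_k) : (u - s *: v) i 0 = u i 0 - s * v i 0 by rewrite !mxE.
  by rewrite mulmxBr -scalemxAr e2 Ww mulr1.
have xx : `|x - (x - s *: w)| <= e by rewrite opprB addrC subrK.
split => Cx; exists (x - s *: w) => //=.
- move=> i; rewrite dif W0x; have := Cx i.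
  have := hWx _ i xsw; have := hbi i; rewrite !ler_norml.
  by move=> /andP[? ?] /andP[? ?] ?; lra.
- move=> i; rewrite W0x; have := Cx i; rewrite dif.
  have := hWx _ i xM'; have := hbi i; rewrite !ler_norml.
  by move=> /andP[? ?] /andP[? ?] ?; lra.
Qed.

Variables (n m : nat) (F : 'cV[R]_n -> 'cV[R]_m -> T -> R) (s : R).
Variables (C : T -> set 'cV[R]_n) (D : T -> set 'cV[R]_m).
Variables (x_ : T -> 'cV[R]_n) (y_ : T -> 'cV[R]_m).
Hypothesis s_gt0 : 0 < s.
Hypothesis scF : forall t, K t -> strongly_convex_concave s (fun x y => F x y t).
Hypothesis ucF : forall M e : R, 0 < e -> exists2 d : R, 0 < d &
  forall (x x' : 'cV[R]_n) (y y' : 'cV[R]_m) t t',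
    `|x| <= M -> `|x'| <= M -> `|y| <= M -> `|y'| <= M ->
    K t -> K t' -> `|x - x'| < d -> `|y - y'| < d -> ball t d t' ->
    `|F x y t - F x' y' t'| < e.
Hypothesis cvxC : forall t, convex_subset (C t).
Hypothesis cvxD : forall t, convex_subset (D t).
Hypothesis hcC : locally_hausdorff_continuous C.
Hypothesis hcD : locally_hausdorff_continuous D.
Hypothesis sad : forall t, K t -> is_saddle (fun x y => F x y t) (C t) (D t) (x_ t) (y_ t).

(* If the saddle point at [t] were far from feasible points [x1], [y1] close to
   the saddle point at [t0], then moving from [(x1, y1)] a bounded step towards
   it would increase the duality gap by a fixed amount; pulling the end of the
   step back to the sets at [t0] contradicts the saddle inequalities there. *)
Lemma saddle_continuous_at t0 (e : R) : K t0 -> 0 < e -> exists2 d : R, 0 < d &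
  forall t, K t -> ball t0 d t -> `|x_ t0 - x_ t| < e /\ `|y_ t0 - y_ t| < e.
Proof.
move=> Kt0 e0; set x0 := x_ t0; set y0 := y_ t0.
pose h := Num.min (e / 3) 1.
have h0 : 0 < h by rewrite lt_min ltr01 divr_gt0.
have h1 : h <= 1 by rewrite ge_min lexx orbT.
have he : h <= e / 3 by rewrite ge_min lexx.
(* Three successive moves, each of length at most 1, lead from [x0] to [x1], [x2] and [x3], and
   likewise for [y]. *)
pose M := `|x0| + `|y0| + 3.
have nx0 : 0 <= `|x0| by []. have ny0 : 0 <= `|y0| by [].
(* A step of relative length [l = h / r] forces a gap of at least [s / 2 * h * r], while the saddle
   point at [t0] allows less than [2 * eps = s / 2 * h * h]. *)
pose eps := s / 4 * h ^+ 2.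
have eps0 : 0 < eps by rewrite mulr_gt0 ?divr_gt0 ?exprn_gt0.
have [dF dF0 HF] := ucF M eps0.
pose e1 := Num.min (dF / 2) h; have e10 : 0 < e1 by rewrite lt_min h0 divr_gt0.
have e1h : e1 <= h by rewrite ge_min lexx orbT.
have e1F : e1 < dF by apply: (@le_lt_trans _ _ (dF / 2)); [rewrite ge_min lexx|lra].
have [dC dC0 HC] := hcC M Kt0 e10; have [dD dD0 HD] := hcD M Kt0 e10.
exists (Num.min dF (Num.min dC dD)); first by rewrite !lt_min dF0 dC0 dD0.
move=> t Kt t0t; have bF : ball t0 dF t by apply: le_ball t0t; rewrite ge_min lexx.
have bC : ball t0 dC t by apply: le_ball t0t; rewrite !ge_min lexx !orbT.
have bD : ball t0 dD t by apply: le_ball t0t; rewrite !ge_min lexx !orbT.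
have [Cx0 Dy0 sad0] := sad Kt0; rewrite -/x0 -/y0 in Cx0 Dy0 sad0.
have [scx scy] := scF Kt.
have x0M : `|x0| <= M by rewrite /M; lra.
have y0M : `|y0| <= M by rewrite /M; lra.
have [/(_ Cx0)[x1 Cx1 x01] _] := HC t Kt bC x0 x0M.
have [/(_ Dy0)[y1 Dy1 y01] _] := HD t Kt bD y0 y0M.
have sadt := sad Kt; have [Cx Dy _] := sadt.
have gap := saddle_gap (scF Kt) (@cvxC t) (@cvxD t) sadt Cx1 Dy1.
set x := x_ t in Cx sadt gap *; set y := y_ t in Dy sadt gap *.
set r2 := _ + _ in gap.
have r20 : 0 <= r2 by rewrite addr_ge0// sqr_ge0.
pose r := Num.sqrt r2; have rr : r ^+ 2 = r2 by rewrite sqr_sqrtr.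
have r0 : 0 <= r by exact: sqrtr_ge0.
have xr : `|x1 - x| <= r.
  apply: (le_trans (normm_le_enorm _)); rewrite -(@ler_pXn2r _ 2) ?nnegrE ?enorm_ge0//.
  by rewrite rr lerDl sqr_ge0.
have yr : `|y1 - y| <= r.
  apply: (le_trans (normm_le_enorm _)); rewrite -(@ler_pXn2r _ 2) ?nnegrE ?enorm_ge0//.
  by rewrite rr lerDr sqr_ge0.
have tri k (u v w : 'cV[R]_k) : `|u - w| <= `|u - v| + `|v - w|.
  by apply: le_trans (ler_normD _ _); rewrite addrA subrK.
suff rh : r <= h.
  have := tri _ x0 x1 x; have := tri _ y0 y1 y; split; lra.
rewrite leNgt; apply/negP => hr.
have rp : 0 < r by exact: lt_trans hr.
pose l := h / r; have l0 : 0 < l by rewrite divr_gt0.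
have l1 : l < 1 by rewrite ltr_pdivrMr// mul1r.
have l01 : 0 <= l <= 1 by rewrite !ltW.
have lr : l * r = h by rewrite mulfVK// gt_eqF.
have step k (u v : 'cV[R]_k) : `|v - u| <= r -> `|v - (l *: u + (1 - l) *: v)| <= h.
  move=> uv; have -> : v - (l *: u + (1 - l) *: v) = l *: (v - u).
    by apply/matrixP=> i j; rewrite !mxE; ring.
  by rewrite normrZ gtr0_norm// -lr ler_wpM2l// ltW.
have stepx := step _ _ _ xr; have stepy := step _ _ _ yr.
have Cx2 := cvxC l01 Cx Cx1; have Dy2 := cvxD l01 Dy Dy1.
(* When these two are added, the terms in [F x1 y1 t] cancel, leaving [l] times the duality gap
   between [(x1, y1)] and the saddle point. *)
have cx := scx y1 x x1 l l01; have cy := scy x1 y y1 l l01.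
set x2 := l *: x + _ in stepx Cx2 cx; set y2 := l *: y + _ in stepy Dy2 cy.
have nrm k (u v : 'cV[R]_k) : `|v| <= `|u| + `|u - v|.
  by have := ler_normB u (u - v); rewrite opprB addrCA subrr addr0.
have x1M : `|x1| <= M by have := nrm _ x0 x1; rewrite /M; lra.
have y1M : `|y1| <= M by have := nrm _ y0 y1; rewrite /M; lra.
have x2M : `|x2| <= `|x0| + 2 by have := nrm _ x1 x2; have := nrm _ x0 x1; lra.
have y2M : `|y2| <= `|y0| + 2 by have := nrm _ y1 y2; have := nrm _ y0 y1; lra.
have x2M' : `|x2| <= M by rewrite /M; lra.
have y2M' : `|y2| <= M by rewrite /M; lra.
have [_ /(_ Cx2)[x3 Cx3 x23]] := HC t Kt bC x2 x2M'.
have [_ /(_ Dy2)[y3 Dy3 y23]] := HD t Kt bD y2 y2M'.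
have x3M : `|x3| <= M by have := nrm _ x2 x3; rewrite /M; lra.
have y3M : `|y3| <= M by have := nrm _ y2 y3; rewrite /M; lra.
have ltF k (u v : 'cV[R]_k) : `|u - v| <= e1 -> `|u - v| < dF.
  by move=> /le_lt_trans; apply.
have bF' := ball_sym bF.
(* [F x1 y2 t] and [F x2 y1 t] are moved to [t0], where [F x0 y3 t0 <= F x0 y0 t0 <= F x3 y0 t0]
   bounds their difference. *)
have := HF _ _ _ _ _ _ x1M x0M y2M' y3M Kt Kt0 _ (ltF _ _ _ y23) bF'.
rewrite distrC => /(_ (ltF _ _ _ x01)) f1.
have := HF _ _ _ _ _ _ x2M' x3M y1M y0M Kt Kt0 (ltF _ _ _ x23) _ bF'.
rewrite [`|y1 - y0|]distrC => /(_ (ltF _ _ _ y01)) f2.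
have /andP[_ g1] := sad0 _ _ Cx3 Dy3; have /andP[g2 _] := sad0 _ _ Cx3 Dy3.
move: f1 f2; rewrite !ltr_norml => /andP[f1 f1'] /andP[f2 f2'].
rewrite -/x2 in cx; rewrite -/y2 in cy.
have ey : enorm (y - y1) = enorm (y1 - y) by exact: enorm_distC.
have ex : enorm (x - x1) = enorm (x1 - x) by exact: enorm_distC.
move: cx cy; rewrite ex ey => cx cy.
have g3 : F x1 y2 t - F x2 y1 t < 2 * eps by lra.
have g4 : l * (s / 2 * r2) <= l * (F x1 y t - F x y1 t) by rewrite ler_wpM2l// ltW.
have g5 : 0 <= s / 2 * l * (1 - l) * r2.
  by rewrite mulr_ge0// mulr_ge0 ?subr_ge0 ?(ltW l1)// mulr_ge0 ?(ltW l0)// divr_ge0// ltW.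
have g6 : s / 2 * l * (1 - l) * r2 = s / 2 * l * (1 - l) * enorm (x1 - x) ^+ 2 +
   s / 2 * l * (1 - l) * enorm (y1 - y) ^+ 2 by rewrite mulrDr.
have g7 : l * (s / 2 * r2) <= F x1 y2 t - F x2 y1 t by lra.
have g8 : l * (s / 2 * r2) = s / 2 * h * r by rewrite -rr -lr; ring.
have g9 : s / 2 * h * h <= s / 2 * h * r.
  by rewrite ler_wpM2l ?(ltW hr)// mulr_ge0 ?(ltW h0)// divr_ge0// ltW.
have : 2 * eps = s / 2 * h * h by rewrite /eps; field.
lra.
Qed.

End parametric_saddle.

Lemma continuous_fst_fst (A B C : topologicalType) :
  continuous (fun p : A * B * C => p.1.1).
Proof. by move=> p; apply: (@continuous_comp _ _ _ fst fst); exact: cvg_fst. Qed.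

Lemma continuous_fst_snd (A B C : topologicalType) :
  continuous (fun p : A * B * C => p.1.2).
Proof.
by move=> p; apply: (@continuous_comp _ _ _ fst snd); [exact: cvg_fst|exact: cvg_snd].
Qed.

(** * Borel measurability of vector-valued maps *)

Section borel_measurability.
Context {R : realType}.

Lemma open_measurable_borelV n (U : set 'cV[R]_n) :
  open U -> measurable (U : set (borelV R n)).
Proof. by move=> oU; apply: sub_sigma_algebra. Qed.

Lemma measurable_fun_borelV d (T : measurableType d) n (u : T -> borelV R n) :
  (forall U : set 'cV[R]_n, open U -> measurable (u @^-1` U)) ->
  measurable_fun [set: T] u.
Proof.
move=> H; apply: (@measurability _ _ T (borelV R n) setT u (@open 'cV[R]_n)) => //.
by move=> _ [U oU <-]; rewrite setTI; exact: H.
Qed.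

Lemma ball_rat_approx n (x : 'cV[R]_n) (e : R) : 0 < e ->
  exists q : 'cV[rat]_n, ball x e (map_mx ratr q : 'cV[R]_n).
Proof.
move=> e0; have H i : exists q : rat, ball (x i 0) e (ratr q : R).
  have [q hq] := @rat_in_itvoo R (x i 0) (x i 0 + e) (ltac:(by rewrite ltrDl)).
  exists q; move: hq; rewrite in_itv /= => /andP[h1 h2].
  by rewrite -ball_normE /= ltr_norml; apply/andP; split; lra.
have [q Hq] := choice H; exists (\col_i q i).
split => // i j; rewrite !mxE (ord1 j); exact: Hq.
Qed.

(** Second countability: [O] is the union of the balls it contains with rational center and radius
    [1 / (k + 1)], and a ball of the product is a product of balls. *)
Lemma measurable_preimage_open3 d (T : measurableType d) a b c
    (u : T -> borelV R a) (v : T -> borelV R b) (w : T -> borelV R c)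
    (O : set ('cV[R]_a * 'cV[R]_b * 'cV[R]_c)) :
  measurable_fun [set: T] u -> measurable_fun [set: T] v ->
  measurable_fun [set: T] w -> open O ->
  measurable [set t | O ((u t : 'cV[R]_a), (v t : 'cV[R]_b), (w t : 'cV[R]_c))].
Proof.
move=> mu mv mw oO.
pose I := ('cV[rat]_a * 'cV[rat]_b * 'cV[rat]_c * nat)%type.
pose ctr (i : I) : 'cV[R]_a * 'cV[R]_b * 'cV[R]_c :=
  (map_mx ratr i.1.1.1, map_mx ratr i.1.1.2, map_mx ratr i.1.2).
pose A (i : I) : set T := if `[< ball (ctr i) i.2.+1%:R^-1 `<=` O >] then
  u @^-1` ball (ctr i).1.1 i.2.+1%:R^-1 `&` v @^-1` ball (ctr i).1.2 i.2.+1%:R^-1 `&`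
  w @^-1` ball (ctr i).2 i.2.+1%:R^-1 else set0.
have -> : [set t | O ((u t : 'cV[R]_a), (v t : 'cV[R]_b), (w t : 'cV[R]_c))] =
    \bigcup_i A i.
  apply/seteqP; split => t /=.
    move=> Ot; have /nbhs_ballP[e /= e0 eO] := open_nbhs_nbhs (conj oO Ot).
    have e2 : 0 < e / 2 by rewrite divr_gt0.
    have [k _ /(_ k (leqnn k)) /= hk] : \forall k \near \oo, (k.+1%:R^-1 : R) < e / 2.
      have /cvgr0_norm_lt/(_ (e / 2) e2) := @cvg_harmonic R.
      by apply: filterS => k; rewrite /harmonic ger0_norm// invr_ge0.
    have k0 : 0 < (k.+1%:R^-1 : R) by rewrite invr_gt0.
    have [qu hu] := ball_rat_approx (u t) k0; have [qv hv] := ball_rat_approx (v t) k0.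
    have [qw hw] := ball_rat_approx (w t) k0.
    exists (qu, qv, qw, k) => //; rewrite /A /= asboolT; last first.
      move=> z hz; apply: eO; rewrite [e]splitr.
      apply: (@ball_triangle _ _ (ctr (qu, qv, qw, k))).
        by split => /=; first split => /=; exact: le_ball (ltW hk) _ _.
      exact: le_ball (ltW hk) _ hz.
    by split; first split; exact: ball_sym.
  move=> [i _]; rewrite /A; case: ifPn => // /asboolP iO [[h1 h2] h3].
  by apply: iO; split; first split.
apply: countable_bigcupT_measurable; first exact: countableP.
move=> i; rewrite /A; case: ifPn => // _.
have mball n (f : T -> borelV R n) x (r : R) : measurable_fun [set: T] f ->
    measurable (f @^-1` (ball (x : 'cV[R]_n) r)).
  move=> mf; rewrite -[X in measurable X]setTI; apply: mf => //.
  apply: open_measurable_borelV; exact: ball_open.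
by apply: measurableI; first apply: measurableI; exact: mball.
Qed.

(** Continuity holds only relative to [K], so the preimage of an open ray is replaced by the
    interior of an implication, which is open in the whole space and agrees with it on [K]. *)
Lemma measurable_fun_comp3 d (T : measurableType d) a b c (K : set 'cV[R]_c)
    (F : 'cV[R]_a -> 'cV[R]_b -> 'cV[R]_c -> R)
    (u : T -> borelV R a) (v : T -> borelV R b) (w : T -> borelV R c) :
  {within [set p : 'cV[R]_a * 'cV[R]_b * 'cV[R]_c | K p.2],
    continuous (fun p => F p.1.1 p.1.2 p.2)} ->
  measurable_fun [set: T] u -> measurable_fun [set: T] v ->
  measurable_fun [set: T] w -> (forall t, K (w t)) ->
  measurable_fun [set: T] (fun t => F (u t) (v t) (w t)).
Proof.
move=> /subspace_continuousP cF mu mv mw Kw.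
apply: (measurability (@RGenOInfty.G R)); first exact: RGenOInfty.measurableE.
move=> _ [_ [r ->] <-]; rewrite setTI.
pose O := interior [set p : 'cV[R]_a * 'cV[R]_b * 'cV[R]_c | K p.2 -> r < F p.1.1 p.1.2 p.2].
have -> : (fun t => F (u t) (v t) (w t)) @^-1` `]r, +oo[ =
    [set t | O ((u t : 'cV[R]_a), (v t : 'cV[R]_b), (w t : 'cV[R]_c))].
  apply/seteqP; split => t /=; rewrite in_itv /= andbT.
    move=> rF; have := cF ((u t : 'cV[R]_a), (v t : 'cV[R]_b), (w t : 'cV[R]_c)) (Kw t).
    by move=> /cvgr_gt/(_ r rF).
  by move=> /interior_subset/(_ (Kw t)).
by apply: measurable_preimage_open3 => //; exact: open_interior.
Qed.

Lemma measurable_fun_continuous_patch a b (K : set 'cV[R]_a) (f : 'cV[R]_a -> 'cV[R]_b) :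
  closed K -> {within K, continuous f} ->
  measurable_fun [set: borelV R a]
    ((fun z => if `[< K z >] then f z else 0) : borelV R a -> borelV R b).
Proof.
move=> clK /subspace_continuousP cf; apply: measurable_fun_borelV => U oU.
pose O := interior [set z | K z -> U (f z)].
have mK : measurable (K : set (borelV R a)).
  rewrite -[X in measurable X]setCK; apply: measurableC.
  by apply: open_measurable_borelV; exact: closed_openC.
have -> : (fun z => if `[< K z >] then f z else 0) @^-1` U =
    (K `&` O) `|` (~` K `&` [set _ | U 0]).
  apply/seteqP; split => z /=.
    case: ifPn => [/asboolP Kz Uz|/asboolP Kz U0]; [left|right] => //; split => //.
    have := cf z Kz U; rewrite /O /interior /= nbhs_simpl /within /=; apply.
    exact: open_nbhs_nbhs.
  case=> [[Kz /interior_subset/(_ Kz)]|[Kz U0]]; first by rewrite asboolT.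
  by rewrite asboolF.
apply: measurableU; apply: measurableI => //; [|exact: measurableC|].
  by apply: open_measurable_borelV; exact: open_interior.
have [U0|U0] := pselect (U 0).
  by rewrite (_ : [set _ | U 0] = setT)//; apply/seteqP; split.
by rewrite (_ : [set _ | U 0] = set0)//; apply/seteqP; split.
Qed.

Lemma continuous_enorm n : continuous (@enorm R n).
Proof.
move=> x; apply: (continuous_comp (f := fun x : 'cV[R]_n => \sum_i x i 0 ^+ 2)); last first.
  exact: sqrt_continuous.
move: x; apply: continuous_big => [|i _ x]; first exact: add_continuous.
apply: (@continuous_comp _ _ _ (fun x : 'cV[R]_n => x i 0) (fun r : R => r ^+ 2)).
  exact: coord_continuous.
exact: exprn_continuous.
Qed.

Lemma measurable_enormB d (T : measurableType d) n (u v : T -> borelV R n) :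
  measurable_fun [set: T] u -> measurable_fun [set: T] v ->
  measurable_fun [set: T] (fun t => enorm ((u t : 'cV[R]_n) - v t)).
Proof.
(* The third variable is a dummy vector of dimension 0. *)
move=> mu mv; apply: (@measurable_fun_comp3 _ _ _ _ 0 setT
  (fun x y _ => enorm (x - y)) u v (fun=> 0)) => //.
apply: continuous_subspaceT => p.
apply: (@continuous_comp _ _ _ (fun p : 'cV[R]_n * 'cV[R]_n * 'cV[R]_0 => p.1.1 - p.1.2)
  (@enorm R n)); last exact: continuous_enorm.
apply: (@cvgB _ _ _ _ _ (fun p : 'cV[R]_n * 'cV[R]_n * 'cV[R]_0 => p.1.1)
  (fun p => p.1.2) p.1.1 p.1.2); [exact: continuous_fst_fst|exact: continuous_fst_snd].
Qed.

End borel_measurability.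

(** * Integrals against a probability measure *)

Section integrals.
Context d (T : measurableType d) (R : realType) (P : probability T R).
Implicit Types f g : T -> R.

(** Positive and negative parts are compared separately, so no integrability is required; [Theta]
    may take infinite values. *)
Lemma ae_le_integral_measurable f g :
  measurable_fun [set: T] f -> measurable_fun [set: T] g ->
  (\forall x \ae P, f x <= g x) ->
  (\int[P]_x (f x)%:E <= \int[P]_x (g x)%:E)%E.
Proof.
move=> /measurable_EFinP mf /measurable_EFinP mg fg.
rewrite integralE [leRHS]integralE; apply: leeB; apply: ae_ge0_le_integral => //.
- exact: measurable_funepos.
- exact: measurable_funepos.
- apply: filterS fg => x fgx _; rewrite !funeposE ge_max !le_max /= !lee_fin fgx /= lexx.
  by rewrite orbT.
- exact: measurable_funeneg.
- exact: measurable_funeneg.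
- apply: filterS fg => x fgx _; rewrite !funenegE ge_max !le_max /= !lee_fin lerN2 fgx /= lexx.
  by rewrite orbT.
Qed.

Lemma integral_cst_probability (c : R) : (\int[P]_x c%:E = c%:E)%E.
Proof. by rewrite integral_cst//= probability_setT mule1. Qed.

Lemma bounded_integrable f (M : R) :
  measurable_fun [set: T] f -> (forall x, `|f x| <= M) -> P.-integrable setT (EFin \o f).
Proof.
move=> mf fM; apply: measurable_bounded_integrable => //.
  by apply: le_lt_trans (@probability_le1 _ _ _ P _ (@measurableT _ T)) (ltry 1).
by exists M; split; [exact: num_real|move=> N MN x _; exact: le_trans (fM x) (ltW MN)].
Qed.

Lemma integrable_of_upper_bound f (M : R) :
  measurable_fun [set: T] f -> (\forall x \ae P, f x <= M) ->
  (-oo < \int[P]_x (f x)%:E)%E -> P.-integrable setT (EFin \o f).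
Proof.
move=> mf fM h; apply/integrableP; split; first exact/measurable_EFinP.
rewrite (integral_fin_num_abs _ _ mf)// fin_real// h /=.
apply: (@le_lt_trans _ _ M%:E); last exact: ltry.
rewrite -integral_cst_probability; apply: ae_le_integral_measurable => //.
Qed.

Lemma Lnorm_le (p e : R) f : 1 <= p -> 0 <= e -> measurable_fun [set: T] f ->
  (forall x, 0 <= f x) -> (\forall x \ae P, f x <= e) ->
  ('N[P]_(p%:E) [(fun x => (f x)%:E)] <= e%:E)%E.
Proof.
move=> p1 e0 mf f0 fe; have p0 : 0 < p by exact: lt_le_trans p1.
rewrite unlock /=.
apply: (@le_trans _ _ ((\int[P]_x ((e `^ p)%:E)) `^ p^-1)%E); last first.
  rewrite integral_cst_probability poweR_EFin -powRrM mulfV ?gt_eqF//.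
  by rewrite powRr1.
apply: gt0_ler_poweR; first by rewrite invr_ge0 ltW.
- by rewrite in_itv /= integral_ge0 ?leey// => x _; exact: poweR_ge0.
- by rewrite in_itv /= integral_cst_probability lee_fin powR_ge0 leey.
have -> : (\int[P]_x (`|(f x)%:E| `^ p) = \int[P]_x ((`|f x| `^ p)%R)%:E)%E.
  by apply: eq_integral => x _; rewrite abse_EFin poweR_EFin.
apply: ae_le_integral_measurable => //.
  apply: (@measurableT_comp _ _ _ _ _ _ (@powR R ^~ p)) => //.
  exact: measurableT_comp.
apply: filterS fe => x fxe; rewrite ger0_norm//.
by apply: ge0_ler_powR => //; rewrite ?nnegrE//; exact: ltW.
Qed.

End integrals.

Lemma within_continuous_comp (U V W : topologicalType) (A : set V) (B : set U)
    (f : V -> W) (g : U -> V) :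
  {within A, continuous f} -> continuous g -> (forall x, B x -> A (g x)) ->
  {within B, continuous (f \o g)}.
Proof.
move=> /subspace_continuousP cf cg BA; apply/subspace_continuousP => x Bx N fN.
have := cg x _ (cf _ (BA _ Bx) _ fN); rewrite !nbhs_simpl /within /=.
by apply: filterS => y h By; exact: h (BA _ By).
Qed.

Section matrix_continuity.
Context {R : realType}.

Lemma cvg_mx (I : Type) (F : set_system I) {FF : Filter F} m n
    (f : I -> 'M[R]_(m, n)) (A : 'M[R]_(m, n)) :
  (forall i j, f x i j @[x --> F] --> A i j) -> f @ F --> A.
Proof.
move=> H N /nbhs_ballP[e /= e0 eN]; rewrite nbhs_simpl.
have : F [set x | forall i, forall j, ball (A i j) e (f x i j)].
  apply: (@filter_forall _ _ (fun i x => forall j, ball (A i j) e (f x i j)) F FF) => i.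
  apply: (@filter_forall _ _ (fun j x => ball (A i j) e (f x i j)) F FF) => j.
  exact: (H i j (ball (A i j) e) (nbhsx_ballx _ _ e0)).
by apply: (@filterS _ F FF) => x h; apply: eN; split.
Qed.

Lemma cvg_mulmx (I : Type) (F : set_system I) {FF : Filter F} m n k (f : I -> 'M[R]_(m, n))
    (g : I -> 'M[R]_(n, k)) (A : 'M[R]_(m, n)) (B : 'M[R]_(n, k)) :
  f @ F --> A -> g @ F --> B -> f x *m g x @[x --> F] --> A *m B.
Proof.
move=> fA gB; apply: cvg_mx => i j.
have -> : (fun x => (f x *m g x) i j) = (fun x => \sum_k0 f x i k0 * g x k0 j).
  by apply/funext => x; rewrite mxE.
rewrite mxE; apply: cvg_big => [|k0 _]; first exact: add_continuous.
apply: cvgM.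
  exact: (cvg_comp _ _ fA (@coord_continuous R m n i k0 A)).
exact: (cvg_comp _ _ gB (@coord_continuous R n k k0 j B)).
Qed.

End matrix_continuity.

Lemma ae_imply d (T : measurableType d) (R : realType) (mu : {measure set T -> \bar R})
    (A B : T -> Prop) :
  (forall x, A x -> B x) -> (\forall x \ae mu, A x) -> \forall x \ae mu, B x.
Proof. by move=> AB; apply: filterS. Qed.

(** Outside the unit ball, with [r = enorm y], strong concavity along the segment from 0 to [y]
    through the unit vector bounds [phi y] by [(2 * M + s / 2) * r - s / 2 * r ^+ 2]; the quotient
    in the statement is the maximum of this over [r]. *)
Lemma strongly_concave_upper_bound (R : realType) n (s M : R)
    (phi : 'cV[R]_n -> R) :
  0 < s -> strongly_convex s (fun y => - phi y) ->
  (forall y, enorm y <= 1 -> `|phi y| <= M) ->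
  forall y, phi y <= M + (2 * M + s / 2) ^+ 2 / (2 * s).
Proof.
move=> s0 sc phiM y.
have M0 : 0 <= M by apply: le_trans (phiM 0 _); rewrite ?enorm0.
have q0 : 0 <= (2 * M + s / 2) ^+ 2 / (2 * s).
  by rewrite divr_ge0 ?sqr_ge0// mulr_ge0// ltW.
have [y1|y1] := leP (enorm y) 1.
  by have := phiM _ y1; rewrite ler_norml => /andP[_ ?]; lra.
set r := enorm y in y1; have r0 : 0 < r by lra.
pose t := r^-1; have t0 : 0 < t by rewrite invr_gt0.
have t1 : t < 1 by rewrite invf_lt1.
have rt : r * t = 1 by rewrite mulfV// gt_eqF.
have t01 : 0 <= t <= 1 by rewrite !ltW.
have := sc y 0 t t01; rewrite scaler0 addr0 subr0 -/r => h.
have : `|phi (t *: y)| <= M by apply: phiM; rewrite enormZ gtr0_norm// mulrC -/r rt.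
rewrite ler_norml => /andP[_ h1].
have : `|phi 0| <= M by apply: phiM; rewrite enorm0.
rewrite ler_norml => /andP[h2 _].
have h3 : r * (- phi (t *: y)) <=
    r * (t * (- phi y) + (1 - t) * (- phi 0) - s / 2 * t * (1 - t) * r ^+ 2).
  by rewrite ler_wpM2l// ltW.
have h4 : r * (t * (- phi y) + (1 - t) * (- phi 0) - s / 2 * t * (1 - t) * r ^+ 2) =
  - phi y - (r - 1) * phi 0 - s / 2 * (r - 1) * r.
  transitivity (- (r * t) * phi y - (r - r * t) * phi 0 - s / 2 * (r * t) * (r - r * t) * r).
    by ring.
  by rewrite rt; ring.
have h5 : r * phi (t *: y) <= r * M by rewrite ler_wpM2l// ltW.
have h6 : (r - 1) * (- phi 0) <= (r - 1) * M by rewrite ler_wpM2l//; lra.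
have h7 : 0 <= s / 2 * (r - (2 * M + s / 2) / s) ^+ 2.
  by rewrite mulr_ge0 ?sqr_ge0// divr_ge0// ltW.
have h8 : s / 2 * (r - (2 * M + s / 2) / s) ^+ 2 =
   s / 2 * r ^+ 2 - (2 * M + s / 2) * r + (2 * M + s / 2) ^+ 2 / (2 * s).
  by field; exact: lt0r_neq0.
lra.
Qed.

(** * From almost every [z] to the whole support *)

Section second_stage.
Variables (R : realType) (n1 m1 n2 m2 l l2 s2 : nat).
Variable D : two_stage_data R n1 m1 n2 m2 l l2 s2.
Variables (d : measure_display) (Omega : measurableType d).
Variables (P : probability Omega R) (xi : {RV P >-> borelV R l}) (sigma : R).
Hypothesis sigma_gt0 : 0 < sigma.
Hypothesis standing : standing_assumptions D xi sigma.
Hypotheses (assA : assumptionA D xi) (assB : assumptionB D xi).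

Local Notation Xi := (Xi xi).

Lemma closed_support : closed Xi.
Proof. by case: assB => cXi _; apply: compact_closed => //; exact: norm_hausdorff. Qed.

(** Otherwise an open neighbourhood of [z] would be covered by two null sets, where [Q] fails and
    outside [Xi], against the definition of the support. *)
Lemma ae_support_dense (Q : set 'cV[R]_l) z U : (\forall z \ae law xi, Q z) ->
  Xi z -> nbhs z U -> exists z', [/\ Xi z', U z' & Q z'].
Proof.
move=> aeQ Xz; rewrite nbhsE => -[V [oV Vz] VU]; apply: contrapT => nex.
have Xixi := standing.1.
have nXi : (law xi).-negligible (~` Xi).
  apply/negligibleP; first by apply: open_measurable_borelV; apply: closed_openC; exact: closed_support.
  apply: eq_trans (measure0 P); congr (P _).
  by apply/seteqP; split => // w /=; apply; exact: Xixi.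
have : (law xi).-negligible V.
  apply: (negligibleS _ (negligibleU aeQ nXi)) => z' Vz'.
  have [Xz'|] := pselect (Xi z'); last by right.
  by left => Qz'; apply: nex; exists z'; split => //; exact: VU.
move=> /negligibleP => /(_ (open_measurable_borelV oV)) V0.
by have := Xz V oV Vz; rewrite V0 ltxx.
Qed.

Lemma ae_le_support (G : 'cV[R]_l -> R) : {within Xi, continuous G} ->
  (\forall z \ae law xi, G z <= 0) -> forall z, Xi z -> G z <= 0.
Proof.
move=> /subspace_continuousP cG aeG z Xz; rewrite leNgt; apply/negP => Gz.
have /cvgr_gt/(_ 0 Gz) := cG z Xz; rewrite /within /= => nG.
have [z' [Xz' /(_ Xz') h1 h2]] := ae_support_dense aeG Xz nG.
by move: h1; rewrite ltNge h2.
Qed.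

Lemma continuous_F2_z x y : {within Xi, continuous (F2 D x y)}.
Proof.
have [cF _ _ _ _] := assA.
apply: (within_continuous_comp (g := fun z : 'cV[R]_l => (x, y, z)) cF) => // z.
exact: (cvg_pair (cvg_cst (x, y)) (@cvg_id _ (nbhs z))).
Qed.

Lemma strongly_convex_concave_support z : Xi z ->
  strongly_convex_concave sigma (fun x y => F2 D x y z).
Proof.
have [_ [_ [_ [_ [_ [_ aesc]]]]]] := standing.
move=> Xz; split => [y x x' t t01|x y y' t t01].
  rewrite -subr_le0; pose e := sigma / 2 * t * (1 - t) * enorm (x - x') ^+ 2.
  apply: (@ae_le_support (fun z => F2 D (t *: x + (1 - t) *: x') y z -
    (t * F2 D x y z + (1 - t) * F2 D x' y z - e))) => //.
    move=> w; have c u : F2 D u y z0 @[z0 --> w] --> F2 D u y w := @continuous_F2_z u y w.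
    exact: (cvgB (c _) (cvgB (cvgD (cvgM (cvg_cst t) (c x)) (cvgM (cvg_cst (1 - t)) (c x')))
      (cvg_cst e))).
  apply: (ae_imply _ aesc) => z' [h _]; rewrite subr_le0; exact: h.
rewrite -subr_le0; pose e := sigma / 2 * t * (1 - t) * enorm (y - y') ^+ 2.
apply: (@ae_le_support (fun z => - F2 D x (t *: y + (1 - t) *: y') z -
  (t * - F2 D x y z + (1 - t) * - F2 D x y' z - e))) => //.
  move=> w; have c u : F2 D x u z0 @[z0 --> w] --> F2 D x u w := @continuous_F2_z x u w.
  exact: (cvgB (cvgN (c _)) (cvgB (cvgD (cvgM (cvg_cst t) (cvgN (c y)))
    (cvgM (cvg_cst (1 - t)) (cvgN (c y')))) (cvg_cst e))).
apply: (ae_imply _ aesc) => z' [_ h]; rewrite subr_le0; exact: h.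
Qed.

End second_stage.

Section polyhedron.
Context {R : realType}.

Lemma convex_polyhedron k n (W : 'M[R]_(k, n)) b :
  convex_subset [set x : 'cV[R]_n | lev (W *m x) b].
Proof.
move=> x y t /andP[t0 t1] /= hx hy i; rewrite mulmxDr -!scalemxAr.
have e2 (u v : 'cV[R]_k) : (t *: u + (1 - t) *: v) i 0 = t * u i 0 + (1 - t) * v i 0.
  by rewrite !mxE.
rewrite e2; have := ler_wpM2l t0 (hx i).
have t1' : 0 <= 1 - t by lra.
by have := ler_wpM2l t1' (hy i); lra.
Qed.

Lemma closed_polyhedron k n (W : 'M[R]_(k, n)) b :
  closed [set x : 'cV[R]_n | lev (W *m x) b].
Proof.
have -> : [set x : 'cV[R]_n | lev (W *m x) b] =
    \bigcap_(i in [set: 'I_k]) [set x | (W *m x) i 0 <= b i 0].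
  by apply/seteqP; split => x /= h; [move=> i _; exact: h|move=> i; exact: h].
apply: closed_bigI => i _.
apply: (@preimage_closed _ _ (fun x => (W *m x) i 0) [set r | r <= b i 0]); last exact: closed_le.
move=> x _; have h : W *m y @[y --> x] --> W *m x.
  exact: (@cvg_mulmx R _ (nbhs x) _ k n 1 (fun=> W) id W x (cvg_cst W) cvg_id).
exact: (cvg_comp _ _ h (@coord_continuous R k 1 i 0 _)).
Qed.

End polyhedron.

(** * The second stage saddle point as a function of [(x1, y1, z)] *)

Section second_stage_map.
Variables (R : realType) (n1 m1 n2 m2 l l2 s2 : nat).
Variable D : two_stage_data R n1 m1 n2 m2 l l2 s2.
Variables (d : measure_display) (Omega : measurableType d).
Variables (P : probability Omega R) (xi : {RV P >-> borelV R l}) (sigma : R).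
Hypothesis sigma_gt0 : 0 < sigma.
Hypothesis standing : standing_assumptions D xi sigma.
Hypotheses (assA : assumptionA D xi) (assB : assumptionB D xi).

Local Notation Xi := (Xi xi).

Definition stage_params : set ('cV[R]_n1 * 'cV[R]_m1 * 'cV[R]_l) :=
  (X1 D `*` Y1 D) `*` Xi.

Local Notation K := stage_params.

Lemma compact_stage_params : compact K.
Proof.
have [_ [[_ cX _ cY] _]] := standing; have [cXi _] := assB.
by apply: compact_setX => //; exact: compact_setX.
Qed.

Lemma continuous_F2_x z y : Xi z -> continuous (fun x => F2 D x y z).
Proof.
have [/subspace_continuousP cF _ _ _ _] := assA => Xz x N FN.
have := cF (x, y, z) Xz N FN; rewrite !nbhs_simpl /within /= => H.
have c : (x', y, z) @[x' --> x] --> (x, y, z).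
  exact: (cvg_pair (cvg_pair (@cvg_id _ (nbhs x)) (cvg_cst y)) (cvg_cst z)).
by have := c _ H; rewrite !nbhs_simpl /=; apply: filterS => x'; exact.
Qed.

Lemma continuous_F2_y z x : Xi z -> continuous (fun y => F2 D x y z).
Proof.
have [/subspace_continuousP cF _ _ _ _] := assA => Xz y N FN.
have := cF (x, y, z) Xz N FN; rewrite !nbhs_simpl /within /= => H.
have c : (x, y', z) @[y' --> y] --> (x, y, z).
  exact: (cvg_pair (cvg_pair (cvg_cst x) (@cvg_id _ (nbhs y))) (cvg_cst z)).
by have := c _ H; rewrite !nbhs_simpl /=; apply: filterS => y'; exact.
Qed.

Let bounded_params (M : R) : set ('cV[R]_n2 * 'cV[R]_m2 * 'cV[R]_l) :=
  ([set x | `|x| <= M] `*` [set y | `|y| <= M]) `*` Xi.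

Let compact_bounded_params M : compact (bounded_params M).
Proof.
have [cXi _] := assB.
by apply: compact_setX => //; apply: compact_setX; exact: compact_normm_le.
Qed.

Let continuous_F2_bounded M :
  {within bounded_params M, continuous (fun w => F2 D w.1.1 w.1.2 w.2)}.
Proof.
have [cF _ _ _ _] := assA; apply: continuous_subspaceW cF.
by move=> w [].
Qed.

Lemma F2_uniformly_continuous (M e : R) : 0 < e -> exists2 r : R, 0 < r &
  forall (x x' : 'cV[R]_n2) (y y' : 'cV[R]_m2) z z',
    `|x| <= M -> `|x'| <= M -> `|y| <= M -> `|y'| <= M -> Xi z -> Xi z' ->
    `|x - x'| < r -> `|y - y'| < r -> ball z r z' ->
    `|F2 D x y z - F2 D x' y' z'| < e.
Proof.
move=> e0; have [r r0 Hr] :=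
  heine_cantor (@compact_bounded_params M) (@continuous_F2_bounded M) e0.
exists r => // x x' y y' z z' xM x'M yM y'M Xz Xz' xx' yy' zz'.
suff : ball (F2 D x y z) e (F2 D x' y' z') by rewrite -ball_normE.
apply: (Hr (x, y, z) (x', y', z')); [by split|by split|].
by split => /=; [split => /=; rewrite -ball_normE|].
Qed.

Lemma F2_bounded (M : R) : exists C : R, forall (x : 'cV[R]_n2) (y : 'cV[R]_m2) z,
  `|x| <= M -> `|y| <= M -> Xi z -> `|F2 D x y z| <= C.
Proof.
have := continuous_compact (@continuous_F2_bounded M) (@compact_bounded_params M).
move=> /compact_bounded[C [_ HC]]; exists (C + 1) => x y z xM yM Xz.
apply: (HC (C + 1)); first by rewrite ltrDl.
by exists (x, y, z).
Qed.

(** No bound on [y] is asked for: competitors in L^p are unbounded. Compactness bounds [F2] for [y]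
    in the unit ball, and strong concavity does the rest. *)
Lemma F2_upper_bound (M : R) : exists C : R, forall (x : 'cV[R]_n2) (y : 'cV[R]_m2) z,
  `|x| <= M -> Xi z -> F2 D x y z <= C.
Proof.
have [C HC] := F2_bounded (Num.max M 1).
exists (C + (2 * C + sigma / 2) ^+ 2 / (2 * sigma)) => x y z xM Xz.
have [_ sc] := strongly_convex_concave_support standing assA assB Xz.
apply: (@strongly_concave_upper_bound _ _ _ _ (fun y => F2 D x y z) sigma_gt0 (sc x)).
move=> u u1; apply: HC => //; first by rewrite le_max xM.
by rewrite le_max (le_trans (normm_le_enorm u) u1) orbT.
Qed.

Lemma X2_polyhedron x1 z :
  X2 D x1 z = [set x | lev (W_ D z *m x) (h_ D z - T_ D z *m x1)].
Proof.
have e2 (u v : 'cV[R]_l2) i : (u + v) i 0 = u i 0 + v i 0 by rewrite mxE.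
have e3 (u v : 'cV[R]_l2) i : (u - v) i 0 = u i 0 - v i 0 by rewrite !mxE.
by apply/seteqP; split => x /= hx i; have := hx i; rewrite e3 e2; lra.
Qed.

Lemma Y2_polyhedron y1 z :
  Y2 D y1 z = [set y | lev (B_ D z *m y) (c_ D z - A_ D z *m y1)].
Proof.
have e2 (u v : 'cV[R]_s2) i : (u + v) i 0 = u i 0 + v i 0 by rewrite mxE.
have e3 (u v : 'cV[R]_s2) i : (u - v) i 0 = u i 0 - v i 0 by rewrite !mxE.
by apply/seteqP; split => x /= hx i; have := hx i; rewrite e3 e2; lra.
Qed.

Lemma convex_X2 x1 z : convex_subset (X2 D x1 z).
Proof. by rewrite X2_polyhedron; exact: convex_polyhedron. Qed.

Lemma convex_Y2 y1 z : convex_subset (Y2 D y1 z).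
Proof. by rewrite Y2_polyhedron; exact: convex_polyhedron. Qed.

Let within_snd (U : topologicalType) (f : 'cV[R]_l -> U) :
  {within Xi, continuous f} -> {within K, continuous (fun t => f t.2)}.
Proof.
move=> cf; apply: (within_continuous_comp (g := snd) cf); last by move=> t [].
by move=> t; exact: cvg_snd.
Qed.

Let within_rhs k n (h : 'cV[R]_l -> 'cV[R]_k) (T : 'cV[R]_l -> 'M[R]_(k, n))
    (pr : 'cV[R]_n1 * 'cV[R]_m1 * 'cV[R]_l -> 'cV[R]_n) :
  {within Xi, continuous h} -> {within Xi, continuous T} -> continuous pr ->
  {within K, continuous (fun t => h t.2 - T t.2 *m pr t)}.
Proof.
move=> /within_snd/subspace_continuousP ch /within_snd/subspace_continuousP cT cpr.
apply/subspace_continuousP => t Kt.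
have cp : pr t' @[t' --> within K (nbhs t)] --> pr t.
  exact: cvg_trans (cvg_app _ (cvg_within _)) (cpr t).
exact: (cvgB (ch t Kt) (cvg_mulmx (cT t Kt) cp)).
Qed.

(** Joint continuity on a compact set supplies all later estimates: bounds, uniform continuity, and
    measurability in [z]. *)
Lemma second_stage_map_exists :
  exists (xs : 'cV[R]_n1 * 'cV[R]_m1 * 'cV[R]_l -> 'cV[R]_n2)
         (ys : 'cV[R]_n1 * 'cV[R]_m1 * 'cV[R]_l -> 'cV[R]_m2),
    [/\ forall t, K t -> saddle_point D t.1.1 t.1.2 t.2 (xs t) (ys t),
        {within K, continuous xs} & {within K, continuous ys}].
Proof.
have [_ _ _ ne2 rf] := assA; have [cXi [[cA cB cT] [cW cc ch]]] := assB.
have scF := strongly_convex_concave_support standing assA assB.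
have /choice[S HS] : forall t : 'cV[R]_n1 * 'cV[R]_m1 * 'cV[R]_l,
    exists s : 'cV[R]_n2 * 'cV[R]_m2,
    K t -> saddle_point D t.1.1 t.1.2 t.2 s.1 s.2.
  move=> t; have [Kt|] := pselect (K t); last by exists (0, 0).
  have [[Xt Yt] Xit] := Kt; have [X0 Y0] := ne2 _ _ _ Xt Yt Xit.
  have [||x [y sad]] := saddle_exists sigma_gt0 (scF _ Xit)
    (convex_X2 (x1 := t.1.1) (z := t.2)) (convex_Y2 (y1 := t.1.2) (z := t.2)) _ _ X0 Y0
    (fun y => @continuous_F2_x t.2 y Xit) (fun x => @continuous_F2_y t.2 x Xit).
  - by rewrite X2_polyhedron; exact: closed_polyhedron.
  - by rewrite Y2_polyhedron; exact: closed_polyhedron.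
  by exists (x, y).
exists (fst \o S), (snd \o S).
have hcX : locally_hausdorff_continuous K (fun t => X2 D t.1.1 t.2).
  under [fun t => X2 D _ _]eq_fun do rewrite X2_polyhedron.
  apply: polyhedron_hausdorff_continuous.
  - exact: (within_snd cW).
  - by apply: within_rhs => //; exact: continuous_fst_fst.
  - by move=> t [_ Xit]; exact: (rf _ Xit).2.
have hcY : locally_hausdorff_continuous K (fun t => Y2 D t.1.2 t.2).
  under [fun t => Y2 D _ _]eq_fun do rewrite Y2_polyhedron.
  apply: polyhedron_hausdorff_continuous.
  - exact: (within_snd cB).
  - by apply: within_rhs => //; exact: continuous_fst_snd.
  - by move=> t [_ Xit]; exact: (rf _ Xit).1.
have key t0 (e : R) : K t0 -> 0 < e -> exists2 r : R, 0 < r &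
    forall t, K t -> ball t0 r t -> `|(S t0).1 - (S t).1| < e /\ `|(S t0).2 - (S t).2| < e.
  apply: (@saddle_continuous_at _ _ K _ _ (fun x y t => F2 D x y t.2) sigma
    (fun t => X2 D t.1.1 t.2) (fun t => Y2 D t.1.2 t.2) (fst \o S) (snd \o S)) => //.
  - by move=> t [_ Xit]; exact: scF.
  - move=> M e' e0'; have [r r0 Hr] := F2_uniformly_continuous M e0'.
    exists r => // x x' y y' t t' ? ? ? ? [_ ?] [_ ?] ? ? [_ ?]; exact: Hr.
  - by move=> t; exact: convex_X2.
  - by move=> t; exact: convex_Y2.
split=> //; apply/subspace_continuousP => t Kt N /nbhs_ballP[e /= e0 eN];
  have [r r0 Hr] := key t e Kt e0; rewrite !nbhs_simpl /within /=;
  apply/nbhs_ballP; exists r => // t' tt' Kt'; apply: eN; rewrite -ball_normE /=.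
- exact: (Hr t' Kt' tt').1.
- exact: (Hr t' Kt' tt').2.
Qed.

End second_stage_map.

(** * Real-valued integrals of affine combinations *)

Section Rintegrals.
Context d (T : measurableType d) (R : realType) (P : probability T R).
Implicit Types f g : T -> R.

Local Notation integrable f := (P.-integrable [set: T] (EFin \o f)).

Lemma integrable_affine f g (a b c : R) : integrable f -> integrable g ->
  integrable (fun x => a * f x + b * g x + c).
Proof.
move=> intf intg.
have h := integrableD measurableT (integrableD measurableT
  (integrableZl measurableT a intf) (integrableZl measurableT b intg))
  (finite_measure_integrable_cst P c measurableT).
exact: h.
Qed.

Lemma Rintegral_affine f g (a b c : R) : integrable f -> integrable g ->
  \int[P]_x (a * f x + b * g x + c) = a * \int[P]_x f x + b * \int[P]_x g x + c.
Proof.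
move=> intf intg.
have ic : integrable (fun=> c) by exact: (finite_measure_integrable_cst P c measurableT).
have ia : integrable (fun x => a * f x) by exact: (integrableZl measurableT a intf).
have ib : integrable (fun x => b * g x) by exact: (integrableZl measurableT b intg).
rewrite RintegralD//; last exact: (integrableD measurableT ia ib).
rewrite RintegralD// !RintegralZl// Rintegral_cst//.
by rewrite -[X in c * fine X]/(P [set: T]) probability_setT mulr1.
Qed.

Lemma EFin_Rintegral f : integrable f -> (\int[P]_x (f x)%:E = (\int[P]_x f x)%:E)%E.
Proof. by move=> intf; rewrite fineK//; exact: integrable_fin_num. Qed.

Lemma measurable_of_integrable f : integrable f -> measurable_fun [set: T] f.
Proof. by move=> /measurable_int/measurable_EFinP. Qed.

Lemma ae_le_Rintegral f g : integrable f -> integrable g ->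
  (\forall x \ae P, f x <= g x) -> \int[P]_x f x <= \int[P]_x g x.
Proof.
move=> intf intg fg; rewrite -lee_fin -!EFin_Rintegral//.
by apply: ae_le_integral_measurable => //; exact: measurable_of_integrable.
Qed.

Lemma Rintegral_dist f g (e : R) : integrable f -> integrable g ->
  (forall x, `|f x - g x| <= e) -> `|\int[P]_x f x - \int[P]_x g x| <= e.
Proof.
move=> intf intg fg.
have half h1 h2 : integrable h1 -> integrable h2 -> (forall x, `|h1 x - h2 x| <= e) ->
    \int[P]_x h1 x <= \int[P]_x h2 x + e.
  move=> int1 int2 h12.
  have -> : \int[P]_x h2 x + e = \int[P]_x (1 * h2 x + 0 * h2 x + e).
    by rewrite Rintegral_affine// mul1r mul0r addr0.
  apply: ae_le_Rintegral => //; first exact: integrable_affine.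
  apply: aeW => x; have := h12 x; rewrite ler_norml => /andP[_ ?]; lra.
rewrite ler_norml; have := half _ _ intf intg fg.
have := half _ _ intg intf; rewrite -(lerD2r (- e)) => H.
have /H : forall x, `|g x - f x| <= e by move=> x; rewrite distrC.
by move=> ? ?; apply/andP; split; lra.
Qed.

End Rintegrals.

(** * Values of the two problems and their comparison *)

Section two_stage.
Variables (R : realType) (n1 m1 n2 m2 l l2 s2 : nat).
Variable D : two_stage_data R n1 m1 n2 m2 l l2 s2.
Variables (d : measure_display) (Omega : measurableType d).
Variables (P : probability Omega R) (xi : {RV P >-> borelV R l}) (sigma p : R).
Hypotheses (sigma_gt0 : 0 < sigma) (p_ge1 : 1 <= p).
Hypothesis standing : standing_assumptions D xi sigma.
Hypotheses (assA : assumptionA D xi) (assB : assumptionB D xi).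

Local Notation Xi := (Xi xi).
Local Notation K := (stage_params D xi).

Variables (xs : 'cV[R]_n1 * 'cV[R]_m1 * 'cV[R]_l -> 'cV[R]_n2).
Variables (ys : 'cV[R]_n1 * 'cV[R]_m1 * 'cV[R]_l -> 'cV[R]_m2).
Hypothesis sad : forall t, K t -> saddle_point D t.1.1 t.1.2 t.2 (xs t) (ys t).
Hypothesis cxs : {within K, continuous xs}.
Hypothesis cys : {within K, continuous ys}.

Let xiXi w : Xi (xi w). Proof. exact: standing.1. Qed.

Let scF z : Xi z -> strongly_convex_concave sigma (fun x y => F2 D x y z).
Proof. exact: (strongly_convex_concave_support standing assA assB). Qed.

(** The value 0 off the closed support makes the solution Borel measurable on the whole space; the
    law does not charge the complement. *)
Definition xsol x1 y1 z := if `[< Xi z >] then xs (x1, y1, z) else 0.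
Definition ysol x1 y1 z := if `[< Xi z >] then ys (x1, y1, z) else 0.

Definition vsol x1 y1 z := F2 D (xsol x1 y1 z) (ysol x1 y1 z) z.

Definition Vsol x1 y1 : R := \int[P]_w vsol x1 y1 (xi w).

Lemma xsolE x1 y1 z : Xi z -> xsol x1 y1 z = xs (x1, y1, z).
Proof. by rewrite /xsol => Xz; rewrite asboolT. Qed.

Lemma ysolE x1 y1 z : Xi z -> ysol x1 y1 z = ys (x1, y1, z).
Proof. by rewrite /ysol => Xz; rewrite asboolT. Qed.

Lemma saddle_sol x1 y1 z : X1 D x1 -> Y1 D y1 -> Xi z ->
  saddle_point D x1 y1 z (xsol x1 y1 z) (ysol x1 y1 z).
Proof. by move=> Xx Yy Xz; rewrite xsolE// ysolE//; apply: (@sad (x1, y1, z)). Qed.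

Lemma sol_bounded : exists2 M : R, 0 <= M & forall x1 y1 z, X1 D x1 -> Y1 D y1 ->
  `|xsol x1 y1 z| <= M /\ `|ysol x1 y1 z| <= M.
Proof.
have cK := compact_stage_params standing assB.
have /compact_bounded[C [_ HC]] := continuous_compact cxs cK.
have /compact_bounded[C' [_ HC']] := continuous_compact cys cK.
exists (`|C| + `|C'| + 1); first by rewrite !addr_ge0.
have lC : C < `|C| + `|C'| + 1 by have := ler_norm C; have := normr_ge0 C'; lra.
have lC' : C' < `|C| + `|C'| + 1 by have := ler_norm C'; have := normr_ge0 C; lra.
move=> x1 y1 z Xx Yy; rewrite /xsol /ysol; case: ifPn => [/asboolP Xz|_].
  by split; [apply: (HC _ lC)|apply: (HC' _ lC')]; exists (x1, y1, z).
by rewrite !normr0 !addr_ge0.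
Qed.

Lemma sol_uniformly_continuous (e : R) : 0 < e -> exists2 r : R, 0 < r &
  forall x1 y1 x1' y1' z, X1 D x1 -> Y1 D y1 -> X1 D x1' -> Y1 D y1' ->
    `|x1 - x1'| < r -> `|y1 - y1'| < r ->
    `|xsol x1 y1 z - xsol x1' y1' z| < e /\ `|ysol x1 y1 z - ysol x1' y1' z| < e.
Proof.
move=> e0; have cK := compact_stage_params standing assB.
have [r r0 Hr] := heine_cantor cK cxs e0; have [q q0 Hq] := heine_cantor cK cys e0.
exists (Num.min r q); first by rewrite lt_min r0.
move=> x1 y1 x1' y1' z Xx Yy Xx' Yy'; rewrite !lt_min => /andP[xr xq] /andP[yr yq].
rewrite /xsol /ysol; case: ifPn => [/asboolP Xz|_]; last by rewrite !subrr !normr0.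
have br : ball (x1, y1, z) r (x1', y1', z).
  by split => /=; [split => /=; rewrite -ball_normE|exact: ballxx].
have bq : ball (x1, y1, z) q (x1', y1', z).
  by split => /=; [split => /=; rewrite -ball_normE|exact: ballxx].
have := Hr (x1, y1, z) (x1', y1', z) _ _ br; have := Hq (x1, y1, z) (x1', y1', z) _ _ bq.
rewrite -!ball_normE /= => h1 h2.
by split; [apply: h2|apply: h1].
Qed.

Lemma measurable_xsol x1 y1 : X1 D x1 -> Y1 D y1 ->
  measurable_fun [set: borelV R l] (xsol x1 y1 : borelV R l -> borelV R n2).
Proof.
move=> Xx Yy; apply: (measurable_fun_continuous_patch (f := fun z => xs (x1, y1, z))).
  exact: (closed_support assB).
apply: (within_continuous_comp (g := fun z : 'cV[R]_l => (x1, y1, z)) cxs) => // z.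
exact: (cvg_pair (cvg_cst (x1, y1)) (@cvg_id _ (nbhs z))).
Qed.

Lemma measurable_ysol x1 y1 : X1 D x1 -> Y1 D y1 ->
  measurable_fun [set: borelV R l] (ysol x1 y1 : borelV R l -> borelV R m2).
Proof.
move=> Xx Yy; apply: (measurable_fun_continuous_patch (f := fun z => ys (x1, y1, z))).
  exact: (closed_support assB).
apply: (within_continuous_comp (g := fun z : 'cV[R]_l => (x1, y1, z)) cys) => // z.
exact: (cvg_pair (cvg_cst (x1, y1)) (@cvg_id _ (nbhs z))).
Qed.

Lemma measurable_F2 (u : 'cV[R]_l -> 'cV[R]_n2) (v : 'cV[R]_l -> 'cV[R]_m2) :
  measurable_fun [set: borelV R l] (u : borelV R l -> borelV R n2) ->
  measurable_fun [set: borelV R l] (v : borelV R l -> borelV R m2) ->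
  measurable_fun [set: Omega] (fun w => F2 D (u (xi w)) (v (xi w)) (xi w)).
Proof.
move=> mu mv; have mxi : measurable_fun [set: Omega] xi by exact: measurable_funPT.
have [cF _ _ _ _] := assA.
apply: (measurable_fun_comp3 (u := u \o xi) (v := v \o xi) (w := xi) cF) => //.
  exact: (measurableT_comp mu mxi).
exact: (measurableT_comp mv mxi).
Qed.

Lemma vsol_bounded : exists C : R, forall x1 y1 z, X1 D x1 -> Y1 D y1 -> Xi z ->
  `|vsol x1 y1 z| <= C.
Proof.
have [M M0 HM] := sol_bounded; have [C HC] := F2_bounded assA assB M.
exists C => x1 y1 z Xx Yy Xz; have [h1 h2] := HM x1 y1 z Xx Yy.
exact: HC.
Qed.

Lemma integrable_vsol x1 y1 : X1 D x1 -> Y1 D y1 ->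
  P.-integrable [set: Omega] (EFin \o (fun w => vsol x1 y1 (xi w))).
Proof.
move=> Xx Yy; have [C HC] := vsol_bounded.
apply: (@bounded_integrable _ _ _ _ _ C).
  by apply: measurable_F2; [exact: measurable_xsol|exact: measurable_ysol].
by move=> w; exact: HC.
Qed.

Lemma psi2E x1 y1 z : X1 D x1 -> Y1 D y1 -> Xi z -> psi2 D x1 y1 z = (vsol x1 y1 z)%:E.
Proof.
move=> Xx Yy Xz; have [Cx Dy sadz] := saddle_sol Xx Yy Xz.
apply/eqP; rewrite eq_le; apply/andP; split.
  apply: (@le_trans _ _ (ereal_sup [set (F2 D (xsol x1 y1 z) y2 z)%:E | y2 in Y2 D y1 z])).
    by apply: ereal_inf_lbound; exists (xsol x1 y1 z).
  apply: ge_ereal_sup => _ [y2 Yy2 <-]; rewrite lee_fin.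
  by have /andP[] := sadz _ _ Cx Yy2.
apply: le_ereal_inf_tmp => _ [x2 Xx2 <-].
apply: (@le_trans _ _ (F2 D x2 (ysol x1 y1 z) z)%:E).
  by rewrite lee_fin; have /andP[] := sadz _ _ Xx2 Dy.
by apply: ereal_sup_ubound; exists (ysol x1 y1 z).
Qed.

Lemma psiE x1 y1 : X1 D x1 -> Y1 D y1 ->
  psi D xi x1 y1 = (F1 D x1 y1 + Vsol x1 y1)%:E.
Proof.
move=> Xx Yy; rewrite /psi.
suff -> : (\int[P]_w psi2 D x1 y1 (xi w) = (Vsol x1 y1)%:E)%E by [].
rewrite -EFin_Rintegral; last exact: integrable_vsol.
by apply: eq_integral => w _; rewrite psi2E.
Qed.

Lemma Vsol_uniformly_continuous (e : R) : 0 < e -> exists2 r : R, 0 < r &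
  forall x1 y1 x1' y1', X1 D x1 -> Y1 D y1 -> X1 D x1' -> Y1 D y1' ->
    `|x1 - x1'| < r -> `|y1 - y1'| < r -> `|Vsol x1 y1 - Vsol x1' y1'| <= e.
Proof.
move=> e0; have [M M0 HM] := sol_bounded.
have [r r0 Hr] := F2_uniformly_continuous assA assB M e0.
have [q q0 Hq] := sol_uniformly_continuous r0; exists q => //.
move=> x1 y1 x1' y1' Xx Yy Xx' Yy' xx yy.
apply: Rintegral_dist; [exact: integrable_vsol|exact: integrable_vsol|move=> w].
have [a b] := HM _ _ (xi w) Xx Yy; have [a' b'] := HM _ _ (xi w) Xx' Yy'.
have [h1 h2] := Hq _ _ _ _ (xi w) Xx Yy Xx' Yy' xx yy.
by apply/ltW/Hr => //; exact: ballxx.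
Qed.

Lemma ae_law (Q : 'cV[R]_l -> Prop) : (\forall z \ae law xi, Q z) ->
  \forall w \ae P, Q (xi w).
Proof.
move=> [N [mN N0 QN]]; exists (xi @^-1` N); split.
- have mxi : measurable_fun [set: Omega] xi by exact: measurable_funPT.
  by rewrite -[X in measurable X]setTI; exact: mxi.
- exact: N0.
- by move=> w /= nQ; apply: QN.
Qed.

Lemma ae_Xi : \forall z \ae law xi, Xi z.
Proof.
exists (~` Xi); split.
- by apply: open_measurable_borelV; apply: closed_openC; exact: (closed_support assB).
- apply: eq_trans (measure0 P); congr (P _).
  by apply/seteqP; split => // w /=; apply; exact: xiXi.
- by [].
Qed.

Lemma ae_and (Q Q' : 'cV[R]_l -> Prop) : (\forall z \ae law xi, Q z) ->
  (\forall z \ae law xi, Q' z) -> \forall z \ae law xi, Q z /\ Q' z.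
Proof. by move=> h h'; apply: (@filterI (borelV R l)). Qed.

Lemma second_stage_solution_sol x1 y1 : X1 D x1 -> Y1 D y1 ->
  second_stage_solution D xi x1 y1 (xsol x1 y1) (ysol x1 y1).
Proof.
move=> Xx Yy; split; [exact: measurable_xsol|exact: measurable_ysol|].
apply: (ae_imply _ ae_Xi) => z Xz; have s := saddle_sol Xx Yy Xz; split => // x2' y2' s'.
exact: (saddle_uniq sigma_gt0 (scF Xz) (@convex_X2 _ _ _ _ _ _ _ _ D x1 z)
  (@convex_Y2 _ _ _ _ _ _ _ _ D y1 z) s s').
Qed.

(** Uniqueness identifies any given solution almost everywhere with the continuous one, on which all
    estimates are made. *)
Lemma second_stage_solutionE x1 y1 x2 y2 : X1 D x1 -> Y1 D y1 ->
  second_stage_solution D xi x1 y1 x2 y2 ->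
  \forall z \ae law xi, Xi z /\ (x2 z = xsol x1 y1 z /\ y2 z = ysol x1 y1 z).
Proof.
move=> Xx Yy [_ _ h]; apply: (ae_imply _ (ae_and ae_Xi h)) => z [Xz [_ uniq]].
by split => //; have [-> ->] := uniq _ _ (saddle_sol Xx Yy Xz).
Qed.

Lemma Lp_dist_le n (u v : 'cV[R]_l -> 'cV[R]_n) (e : R) :
  measurable_fun [set: borelV R l] (u : borelV R l -> borelV R n) ->
  measurable_fun [set: borelV R l] (v : borelV R l -> borelV R n) ->
  0 <= e -> (\forall z \ae law xi, enorm (u z - v z) <= e) ->
  (Lp_dist (law xi) p u v <= e%:E)%E.
Proof.
move=> mu mv e0 uv; apply: (@Lnorm_le _ _ _ (law xi) p e (fun z => enorm (u z - v z))) => //.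
  exact: measurable_enormB.
by move=> z; exact: enorm_ge0.
Qed.

Lemma Lp_space_bounded n (u : 'cV[R]_l -> 'cV[R]_n) (M : R) :
  measurable_fun [set: borelV R l] (u : borelV R l -> borelV R n) ->
  0 <= M -> (\forall z \ae law xi, `|u z| <= M) -> Lp_space (law xi) p u.
Proof.
move=> mu M0 uM; split => //.
have m0 : measurable_fun [set: borelV R l] ((fun=> 0) : borelV R l -> borelV R n) by [].
have := @Lp_dist_le n u (fun=> 0) (n%:R * M) mu m0 _ _.
rewrite /Lp_dist; under [fun z => (enorm (_ - _))%:E]funext do rewrite subr0.
move=> h; apply: le_lt_trans (h _ _) (ltry _); first by rewrite mulr_ge0.
apply: (ae_imply _ uM) => z uz; rewrite subr0; apply: (le_trans (enorm_le_normm _)).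
by rewrite ler_wpM2l.
Qed.

Section solution.
Variables (x1 : 'cV[R]_n1) (y1 : 'cV[R]_m1).
Variables (x2 : 'cV[R]_l -> 'cV[R]_n2) (y2 : 'cV[R]_l -> 'cV[R]_m2).
Hypotheses (Xx1 : X1 D x1) (Yy1 : Y1 D y1).
Hypothesis sol : second_stage_solution D xi x1 y1 x2 y2.

Lemma solution_bX : bX D xi p (x1, x2).
Proof.
have [mx my ae_sad] := sol; have [M M0 HM] := sol_bounded.
split => //=; last by apply: (ae_imply _ ae_sad) => z [[]].
apply: (Lp_space_bounded mx M0).
apply: (ae_imply _ (second_stage_solutionE Xx1 Yy1 sol)) => z [_ [-> _]].
by have [] := HM x1 y1 z Xx1 Yy1.
Qed.

Lemma solution_bY : bY D xi p (y1, y2).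
Proof.
have [mx my ae_sad] := sol; have [M M0 HM] := sol_bounded.
split => //=; last by apply: (ae_imply _ ae_sad) => z [[]].
apply: (Lp_space_bounded my M0).
apply: (ae_imply _ (second_stage_solutionE Xx1 Yy1 sol)) => z [_ [_ ->]].
by have [] := HM x1 y1 z Xx1 Yy1.
Qed.

Lemma Theta_solution : Theta D xi (x1, x2) (y1, y2) = psi D xi x1 y1.
Proof.
have [mx my _] := sol; rewrite psiE// EFinD /Theta /=.
suff -> : (\int[P]_w (F2 D (x2 (xi w)) (y2 (xi w)) (xi w))%:E = (Vsol x1 y1)%:E)%E by [].
rewrite -EFin_Rintegral; last exact: integrable_vsol.
have mv : measurable_fun [set: Omega] (fun w => vsol x1 y1 (xi w)).
  by apply: measurable_F2; [exact: measurable_xsol|exact: measurable_ysol].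
have mF := measurable_F2 mx my.
have aeE := ae_law (second_stage_solutionE Xx1 Yy1 sol).
by apply/eqP; rewrite eq_le; apply/andP; split; apply: ae_le_integral_measurable => //;
  apply: (ae_imply _ aeE) => w [_ [-> ->]].
Qed.

End solution.

(** The minimizing half of the saddle inequality, pointwise in [z]; the right-hand side may be
    infinite. *)
Lemma psi_le_Theta x1 y1 x2 : X1 D x1 -> Y1 D y1 -> bX D xi p (x1, x2) ->
  (psi D xi x1 y1 <= Theta D xi (x1, x2) (y1, ysol x1 y1))%E.
Proof.
move=> Xx Yy [[mx _] _ feas]; rewrite psiE// EFinD /Theta /=; apply: leeD2l.
rewrite -EFin_Rintegral; last exact: integrable_vsol.
apply: ae_le_integral_measurable.
- by apply: measurable_F2; [exact: measurable_xsol|exact: measurable_ysol].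
- by apply: measurable_F2 => //; exact: measurable_ysol.
apply: (ae_imply _ (ae_law feas)) => w fw.
have [Cx Dy s] := saddle_sol Xx Yy (@xiXi w).
by have /andP[] := s _ _ fw Dy.
Qed.

Lemma convex_joint_Y2 y y' u u' z t : 0 <= t <= 1 -> Y2 D y z u -> Y2 D y' z u' ->
  Y2 D (t *: y + (1 - t) *: y') z (t *: u + (1 - t) *: u').
Proof.
move=> /andP[t0 t1] hu hu' i; have t1' : 0 <= 1 - t by lra.
rewrite !mulmxDr -!scalemxAr.
have e2 (a b c e : 'cV[R]_s2) : (t *: a + (1 - t) *: b + (t *: c + (1 - t) *: e)) i 0 =
    t * ((a + c) i 0) + (1 - t) * ((b + e) i 0) by rewrite !mxE; ring.
rewrite e2; have := ler_wpM2l t0 (hu i); have := ler_wpM2l t1' (hu' i).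
by lra.
Qed.

(** The combination of [u] and [u'] is feasible at the intermediate point, since the constraint is
    jointly affine; the saddle inequality there and concavity in [y2] conclude. With saddle
    maximizers it gives concavity of the value, with a competitor the first order estimate. *)
Lemma vsol_segment x1 y y' t z u u' : X1 D x1 -> Y1 D (t *: y + (1 - t) *: y') ->
  0 <= t <= 1 -> Xi z -> Y2 D y z u -> Y2 D y' z u' ->
  t * F2 D (xsol x1 (t *: y + (1 - t) *: y') z) u z +
    (1 - t) * F2 D (xsol x1 (t *: y + (1 - t) *: y') z) u' z <=
  vsol x1 (t *: y + (1 - t) *: y') z.
Proof.
move=> Xx Yt t01 Xz hu hu'; set xt := xsol _ _ _; have [Cx _ s] := saddle_sol Xx Yt Xz.
have /andP[h _] := s _ _ Cx (convex_joint_Y2 t01 hu hu').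
have [_ sc] := scF Xz; have := sc xt u u' t t01; rewrite -/xt in h.
have e0 : 0 <= sigma / 2 * t * (1 - t) * enorm (u - u') ^+ 2.
  have /andP[t0 t1] := t01.
  rewrite mulr_ge0 ?sqr_ge0// mulr_ge0 ?subr_ge0// mulr_ge0// divr_ge0// ltW//.
by move: h; rewrite /vsol -/xt; lra.
Qed.

Let cvxY1 : convex_subset (Y1 D).
Proof.
have [_ [[_ _ cY _] _]] := standing; move=> x y t /andP[t0 t1] Yx Yy.
have := cY x y (Itv01 t0 t1); rewrite !inE => /(_ Yx Yy).
by rewrite /conv /=.
Qed.

Lemma vsol_concave x1 y y' t z : X1 D x1 -> Y1 D y -> Y1 D y' -> 0 <= t <= 1 -> Xi z ->
  t * vsol x1 y z + (1 - t) * vsol x1 y' z <= vsol x1 (t *: y + (1 - t) *: y') z.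
Proof.
move=> Xx Yy Yy' t01 Xz; have Yt := cvxY1 t01 Yy Yy'.
have [_ Du s] := saddle_sol Xx Yy Xz; have [_ Du' s'] := saddle_sol Xx Yy' Xz.
apply: le_trans (vsol_segment Xx Yt t01 Xz Du Du').
have [Ct _ _] := saddle_sol Xx Yt Xz.
have /andP[_ h] := s _ _ Ct Du; have /andP[_ h'] := s' _ _ Ct Du'.
have /andP[t0 t1] := t01; have t1' : 0 <= 1 - t by lra.
by apply: lerD; apply: ler_wpM2l.
Qed.

Lemma Vsol_concave x1 y y' t : X1 D x1 -> Y1 D y -> Y1 D y' -> 0 <= t <= 1 ->
  t * Vsol x1 y + (1 - t) * Vsol x1 y' <= Vsol x1 (t *: y + (1 - t) *: y').
Proof.
move=> Xx Yy Yy' t01; have Yt := cvxY1 t01 Yy Yy'.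
have i1 := integrable_vsol Xx Yy; have i2 := integrable_vsol Xx Yy'.
have -> : t * Vsol x1 y + (1 - t) * Vsol x1 y' =
    \int[P]_w (t * vsol x1 y (xi w) + (1 - t) * vsol x1 y' (xi w) + 0).
  by rewrite Rintegral_affine// addr0.
apply: ae_le_Rintegral; [exact: integrable_affine|exact: integrable_vsol|].
by apply: aeW => w; rewrite addr0; exact: vsol_concave.
Qed.

Lemma strongly_convex_F1 x1 : X1 D x1 -> strongly_convex sigma (fun y => - F1 D x1 y).
Proof.
have [_ [_ [_ [_ [_ [sc _]]]]]] := standing.
by move=> /sc h y y' t t01; have := h y y' t t01; rewrite /F1; lra.
Qed.

Lemma strongly_convex_stage1 x1 : X1 D x1 ->
  strongly_convex_on sigma (Y1 D) (fun y => - (F1 D x1 y + Vsol x1 y)).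
Proof.
move=> Xx y y' t Yy Yy' t01; have := strongly_convex_F1 Xx y y' t01.
by have := Vsol_concave Xx Yy Yy' t01; lra.
Qed.

(* Compare [y1'] with the points of the segment from [y1]: the second stage
   maximizers may be combined along the segment, and the minimizers [xt] there
   tend to [x2]. As [F2] may not be integrable uniformly in [y2'], the passage to
   the limit uses convexity: [x2] is a convex combination of [xt] and of the
   bounded point [x2 + (1 - s) / s *: (x2 - xt)], at which [F2] is bounded above. *)
Lemma Theta_le_local_max x1 y1 x2 y2 r : X1 D x1 -> Y1 D y1 ->
  second_stage_solution D xi x1 y1 x2 y2 -> 0 < r ->
  (forall y, Y1 D y -> enorm (y - y1) <= r -> (psi D xi x1 y <= psi D xi x1 y1)%E) ->
  forall y1' y2', bY D xi p (y1', y2') ->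
    (Theta D xi (x1, x2) (y1', y2') <= psi D xi x1 y1)%E.
Proof.
move=> Xx Yy sol r0 locmax y1' y2' [[my' _] /= Yy' feas].
have [mx my _] := sol; have [M M0 HM] := sol_bounded.
(* The extra 1 leaves room for the extrapolated point [x']: as [xt] is within [s] of [xb], [x'] is
   within 1 of it. *)
have [C HC] := F2_upper_bound sigma_gt0 standing assA assB (M + 1).
pose G w := F2 D (x2 (xi w)) (y2' (xi w)) (xi w).
have mG : measurable_fun [set: Omega] G by exact: measurable_F2.
have aeE := ae_law (second_stage_solutionE Xx Yy sol).
have GC : \forall w \ae P, G w <= C.
  apply: (ae_imply _ aeE) => w [Xw [x2E _]]; apply: HC => //; rewrite x2E.
  by apply: (le_trans (HM x1 y1 (xi w) Xx Yy).1); rewrite lerDl.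
rewrite psiE// /Theta /=.
have [->|/eqP Ginf] := eqVneq (\int[P]_w (G w)%:E)%E -oo%E.
  by rewrite addeNy leNye.
have iG : P.-integrable [set: Omega] (EFin \o G).
  by apply: (integrable_of_upper_bound mG GC); rewrite ltNye; exact/eqP.
rewrite [X in (_ + X)%E](EFin_Rintegral iG) -EFinD lee_fin.
set IG := \int[P]_x G x; set Pm := F1 D x1 y1 + Vsol x1 y1.
(* Here [s] bounds the displacement of the second stage minimizers; the inequality is proved up to
   an error linear in [s]. *)
apply: (@ler_of_linear_error _ _ _ (F1 D x1 y1' + C - Pm)) => s /andP[s0 s1].
have [q q0 Hq] := sol_uniformly_continuous s0.
pose N := enorm (y1' - y1) + 1.
have N0 : 0 < N by rewrite ltr_wpDl// enorm_ge0.
(* The last two bounds keep [yt] inside the region of local maximality and make the second stage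
   solutions there [s]-close. *)
pose t := Num.min (1 / 2) (Num.min (r / N) (q / (2 * N))).
have t0 : 0 < t by rewrite !lt_min !divr_gt0// mulr_gt0.
have t12 : t <= 1 / 2 by rewrite ge_min lexx.
have t01 : 0 <= t <= 1 by apply/andP; split; lra.
have tr : t * N <= r by rewrite -ler_pdivlMr// !ge_min lexx !orbT.
have tq : t * N < q.
  apply: (@le_lt_trans _ _ (q / 2)); last by lra.
  have : t <= q / (2 * N) by rewrite !ge_min lexx !orbT.
  rewrite -(ler_pM2r N0); congr (_ <= _); field; exact: lt0r_neq0.
pose yt := t *: y1' + (1 - t) *: y1.
have Yt : Y1 D yt by exact: cvxY1.
have dyt : enorm (yt - y1) <= t * N.
  have -> : yt - y1 = t *: (y1' - y1).
    by apply/matrixP => i j; rewrite !mxE; ring.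
  by rewrite enormZ gtr0_norm// ler_wpM2l ?(ltW t0)// lerDl.
(* This is [vsol_segment] scaled by [1 - s]: convexity in [x2] then trades the value at [xt] for the
   integrable [G] and the constant [C]. *)
have step : \forall w \ae P,
   (1 - s) * (1 - t) * vsol x1 y1 (xi w) + t * G w + - (t * s * C) <=
   (1 - s) * vsol x1 yt (xi w).
  have aeF := ae_law (ae_and (second_stage_solutionE Xx Yy sol) feas).
  apply: (ae_imply _ aeF) => w [[Xw [x2E _]] Yw]; rewrite /G x2E.
  set z := xi w in Xw Yw *; set xb := xsol x1 y1 z; set xt := xsol x1 yt z.
  have [Cb Db sb] := saddle_sol Xx Yy Xw; have [Ct Dt st] := saddle_sol Xx Yt Xw.
  have h1 := vsol_segment Xx Yt t01 Xw Yw Db; rewrite -/yt -/xt in h1.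
  have /andP[_ h2] := sb _ _ Ct Db.
  have dx : `|xt - xb| < s.
    apply: (Hq _ _ _ _ z Xx Yt Xx Yy _ _).1; first by rewrite subrr normr0.
    exact: le_lt_trans (le_trans (normm_le_enorm _) dyt) tq.
  pose x' := xb + ((1 - s) / s) *: (xb - xt).
  have h3 : F2 D x' (y2' z) z <= C.
    apply: HC => //; apply: (le_trans (ler_normD _ _)); apply: lerD.
      by have [] := HM x1 y1 z Xx Yy.
    rewrite normrZ ger0_norm ?divr_ge0 ?(ltW s0)//; last by lra.
    rewrite distrC mulrAC ler_pdivrMr// mul1r.
    apply: (@le_trans _ _ (1 * `|xt - xb|)); last by rewrite mul1r ltW.
    by rewrite ler_wpM2r//; lra.
  have h4 : F2 D xb (y2' z) z <= (1 - s) * F2 D xt (y2' z) z + s * F2 D x' (y2' z) z.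
    have s01 : 0 <= s <= 1 by apply/andP; split; lra.
    have -> : xb = s *: x' + (1 - s) *: xt.
      by apply/matrixP => i j; rewrite !mxE; field; exact: lt0r_neq0.
    have [sc _] := scF Xw; have := sc (y2' z) x' xt s s01.
    have : 0 <= sigma / 2 * s * (1 - s) * enorm (x' - xt) ^+ 2.
      rewrite mulr_ge0 ?sqr_ge0// mulr_ge0 ?subr_ge0 ?(ltW s1)// mulr_ge0 ?(ltW s0)//.
      by rewrite divr_ge0// ltW.
    by lra.
  have k1 : (1 - s) * (t * F2 D xt (y2' z) z + (1 - t) * F2 D xt (ysol x1 y1 z) z) <=
      (1 - s) * vsol x1 yt z by rewrite ler_wpM2l//; lra.
  have k2 : t * F2 D xb (y2' z) z <=
      t * ((1 - s) * F2 D xt (y2' z) z + s * F2 D x' (y2' z) z).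
    by rewrite ler_wpM2l// ltW.
  have k3 : t * s * F2 D x' (y2' z) z <= t * s * C.
    by rewrite ler_wpM2l// mulr_ge0// ltW.
  have k4 : (1 - s) * (1 - t) * vsol x1 y1 z <=
      (1 - s) * (1 - t) * F2 D xt (ysol x1 y1 z) z.
    by rewrite ler_wpM2l// mulr_ge0//; lra.
  by lra.
have iv := integrable_vsol Xx Yy; have ivt := integrable_vsol Xx Yt.
have : (1 - s) * (1 - t) * Vsol x1 y1 + t * IG + - (t * s * C) <= (1 - s) * Vsol x1 yt.
  rewrite -Rintegral_affine//.
  have -> : (1 - s) * Vsol x1 yt =
      \int[P]_w ((1 - s) * vsol x1 yt (xi w) + 0 * vsol x1 yt (xi w) + 0).
    by rewrite Rintegral_affine// mul0r !addr0.
  apply: ae_le_Rintegral; [exact: integrable_affine|exact: integrable_affine|].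
  by apply: (ae_imply _ step) => w; rewrite mul0r !addr0.
have := locmax _ Yt (le_trans dyt tr); rewrite !psiE// lee_fin -/Pm => h1 h2.
have := strongly_convex_F1 Xx y1' y1 t01; rewrite -/yt.
have e0 : 0 <= sigma / 2 * t * (1 - t) * enorm (y1' - y1) ^+ 2.
  rewrite mulr_ge0 ?sqr_ge0// mulr_ge0 ?subr_ge0//; last by lra.
  by rewrite mulr_ge0 ?(ltW t0)// divr_ge0// ltW.
move=> h3.
(* Local maximality at [yt] and concavity of [F1] bound the increase of [Vsol] to first order in
   [t]; the terms of order 0 then cancel and [t] is divided out. *)
have h4 : (1 - s) * Vsol x1 yt <= (1 - s) * (Vsol x1 y1 + t * (F1 D x1 y1 - F1 D x1 y1')).
  by rewrite ler_wpM2l//; rewrite /Pm in h1; lra.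
have : 0 <= t * ((1 - s) * (Pm - F1 D x1 y1') + s * C - IG) by rewrite /Pm; lra.
by rewrite pmulr_rge0//; rewrite /Pm; lra.
Qed.

(** * First stage maximizers *)

Lemma psi1_continuous : continuous (fun q : 'cV[R]_n1 * 'cV[R]_m1 => psi1 D q.1 q.2).
Proof.
have [_ [_ [_ [_ [[dpsi _ _] _]]]]] := standing.
have -> : (fun q : 'cV[R]_n1 * 'cV[R]_m1 => psi1 D q.1 q.2) =
    stacked (psi1 D) \o (fun q => col_mx q.1 q.2).
  by apply/funext => q; rewrite /stacked /= col_mxKu col_mxKd.
move=> q; apply: (@continuous_comp _ _ _ (fun q => col_mx q.1 q.2) (stacked (psi1 D))).
  apply: (@cvg_mx R _ (nbhs q) _ _ _ (fun q => col_mx q.1 q.2) (col_mx q.1 q.2)) => i j.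
  rewrite (ord1 j) mxE.
  under eq_cvg do rewrite mxE.
  case: (fintype.split i) => k.
    exact: (cvg_comp _ _ (@cvg_fst _ _ (nbhs q.1) (nbhs q.2) _) (@coord_continuous R n1 1 k 0 _)).
  exact: (cvg_comp _ _ (@cvg_snd _ _ (nbhs q.1) (nbhs q.2) _) (@coord_continuous R m1 1 k 0 _)).
exact: differentiable_continuous.
Qed.

Lemma psi1_uniformly_continuous (e : R) : 0 < e -> exists2 r : R, 0 < r &
  forall x x' y y', X1 D x -> X1 D x' -> Y1 D y -> Y1 D y' ->
    `|x - x'| < r -> `|y - y'| < r -> `|psi1 D x y - psi1 D x' y'| < e.
Proof.
move=> e0; have [_ [[_ cX _ cY] _]] := standing.
have [r r0 Hr] := heine_cantor (compact_setX cX cY) (continuous_subspaceT psi1_continuous) e0.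
exists r => // x x' y y' Xx Xx' Yy Yy' xx yy.
suff : ball (psi1 D x y) e (psi1 D x' y') by rewrite -ball_normE.
apply: (Hr (x, y) (x', y')); [by split|by split|].
by split => /=; rewrite -ball_normE.
Qed.

(** The quadratic growth is built in, as it is what compares maximizers for different [x1]; strong
    concavity gives it for any maximizer. *)
Definition stage1_argmax x1 y1 := Y1 D y1 /\ forall y, Y1 D y ->
  F1 D x1 y + Vsol x1 y + sigma / 2 * enorm (y - y1) ^+ 2 <= F1 D x1 y1 + Vsol x1 y1.

Lemma stage1_argmax_exists x1 : X1 D x1 -> Y1 D !=set0 -> exists y1, stage1_argmax x1 y1.
Proof.
move=> Xx Y0; have [_ [[_ _ _ cY] [_ [lscg _]]]] := standing.
have clY : closed (Y1 D) by apply: compact_closed => //; exact: norm_hausdorff.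
have clS c : closed [set y | Y1 D y /\ - (F1 D x1 y + Vsol x1 y) <= c].
  rewrite -[X in closed X]setCK; apply: open_closedC; rewrite openE => y /= nS.
  have [Yy|nY] := pselect (Y1 D y); last first.
    have : nbhs y (~` Y1 D) by apply: open_nbhs_nbhs; split => //; exact: closed_openC.
    by apply: filterS => y' nY' [].
  have gt : c < - (F1 D x1 y + Vsol x1 y).
    by rewrite ltNge; apply/negP => ?; apply: nS.
  (* One third of the excess for each of [g_], [psi1] and [Vsol]; of [g_] only lower semicontinuity
     is available. *)
  pose e := (- (F1 D x1 y + Vsol x1 y) - c) / 3.
  have e0 : 0 < e by rewrite divr_gt0// subr_gt0.
  have [V nV HV] := lscg y (g_ D y - e) (ltac:(by rewrite /= lte_fin; lra)).
  have [r r0 Hr] := psi1_uniformly_continuous e0.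
  have [q q0 Hq] := Vsol_uniformly_continuous e0.
  have nr := nbhsx_ballx y r r0; have nq := nbhsx_ballx y q q0.
  apply: filterS (filterI nV (filterI nr nq)) => y' [Vy' [br bq]] [Yy' hc].
  have x0 k : 0 < k -> `|x1 - x1| < k by rewrite subrr normr0.
  have := HV _ Vy'; rewrite /= lte_fin => h1.
  have h2 : `|psi1 D x1 y - psi1 D x1 y'| < e.
    by apply: Hr => //; [exact: x0|move: br; rewrite -ball_normE].
  have h3 : `|Vsol x1 y - Vsol x1 y'| <= e.
    by apply: Hq => //; [exact: x0|move: bq; rewrite -ball_normE].
  move: h2 h3; rewrite ltr_norml ler_norml => /andP[h2 _] /andP[h3 _].
  have : - (F1 D x1 y + Vsol x1 y) = c + 3 * e by rewrite /e; field.
  by move: hc; rewrite /F1; lra.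
have [y1 Yy1 h] := strongly_convex_argmin sigma_gt0 cvxY1 (strongly_convex_stage1 Xx) clS Y0.
by exists y1; split => // y Yy; have := h y Yy; lra.
Qed.

Lemma stage1_argmaxP x1 y1 : X1 D x1 -> Y1 D y1 ->
  (forall y, Y1 D y -> (psi D xi x1 y <= psi D xi x1 y1)%E) -> stage1_argmax x1 y1.
Proof.
move=> Xx Yy h; split => // y Yy'.
have := @strongly_convex_growth _ _ sigma (Y1 D) _ cvxY1 (strongly_convex_stage1 Xx) y1 Yy.
move=> /(_ _ y Yy')/wrap[|]; last by lra.
by move=> u Yu; have := h u Yu; rewrite !psiE// lee_fin lerN2.
Qed.

Lemma stage1_argmax_psi x1 y1 : X1 D x1 -> stage1_argmax x1 y1 ->
  forall y, Y1 D y -> (psi D xi x1 y <= psi D xi x1 y1)%E.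
Proof.
move=> Xx [Yy h] y Yy'; rewrite !psiE// lee_fin; apply: le_trans (h y Yy').
by rewrite lerDl mulr_ge0 ?sqr_ge0// divr_ge0// ltW.
Qed.

(** Adding the growth inequalities of the two maximizers cancels [f_] and [g_], which need not be
    continuous; only differences of [psi1] and [Vsol] remain. *)
Lemma stage1_argmax_continuous x1 y1 (e : R) : X1 D x1 -> stage1_argmax x1 y1 -> 0 < e ->
  exists2 r : R, 0 < r & forall x1' y1', X1 D x1' -> stage1_argmax x1' y1' ->
    `|x1 - x1'| < r -> `|y1 - y1'| < e.
Proof.
(* Four differences of size at most [k] add up to half of [sigma * e ^+ 2]. *)
move=> Xx [Yy h] e0; pose k := sigma / 8 * e ^+ 2.
have k0 : 0 < k by rewrite mulr_gt0 ?exprn_gt0// divr_gt0.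
have [r r0 Hr] := psi1_uniformly_continuous k0.
have [q q0 Hq] := Vsol_uniformly_continuous k0.
exists (Num.min r q); first by rewrite lt_min r0.
move=> x1' y1' Xx' [Yy' h']; rewrite lt_min => /andP[xr xq].
have y0 (y : 'cV[R]_m1) c : 0 < c -> `|y - y| < c by rewrite subrr normr0.
have := Hr _ _ _ _ Xx Xx' Yy Yy xr (y0 _ _ r0).
have := Hr _ _ _ _ Xx Xx' Yy' Yy' xr (y0 _ _ r0).
have := Hq _ _ _ _ Xx Yy Xx' Yy xq (y0 _ _ q0).
have := Hq _ _ _ _ Xx Yy' Xx' Yy' xq (y0 _ _ q0).
rewrite !ler_norml !ltr_norml => /andP[a1 a2] /andP[b1 b2] /andP[c1 c2] /andP[d1 d2].
have := h _ Yy'; have := h' _ Yy; rewrite (enorm_distC y1' y1) /F1.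
set u := enorm _ ^+ 2 => k1 k2.
have : sigma * u < sigma * e ^+ 2.
  have : k * 8 = sigma * e ^+ 2 by rewrite /k; field.
  by have : 0 < sigma * e ^+ 2; [rewrite mulr_gt0// exprn_gt0|lra].
rewrite ltr_pM2l// ltr_pXn2r ?nnegrE ?enorm_ge0 ?(ltW e0)//.
exact: le_lt_trans (normm_le_enorm _).
Qed.

Lemma sup_psi_le_sup_Theta x : bX D xi p x ->
  (ereal_sup [set psi D xi x.1 y' | y' in Y1 D] <=
   ereal_sup [set Theta D xi x y' | y' in bY D xi p])%E.
Proof.
case: x => x1 x2 Xx; have [_ /= Xx1 _] := Xx.
apply: ge_ereal_sup => _ [y1 Yy1 <-]; apply: le_trans (psi_le_Theta Xx1 Yy1 Xx) _.
apply: ereal_sup_ubound; exists (y1, ysol x1 y1) => //.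
exact: (solution_bY Xx1 Yy1 (second_stage_solution_sol Xx1 Yy1)).
Qed.

(** Relies on the second component being the solution at the maximizer [y1]; for a general feasible
    one only the opposite inequality is established. *)
Lemma sup_Theta_le_sup_psi x1 y1 : X1 D x1 -> stage1_argmax x1 y1 ->
  (ereal_sup [set Theta D xi (x1, xsol x1 y1) y' | y' in bY D xi p] <=
   ereal_sup [set psi D xi x1 y' | y' in Y1 D])%E.
Proof.
move=> Xx amax; have Yy := amax.1.
apply: (@le_trans _ _ (psi D xi x1 y1)); last by apply: ereal_sup_ubound; exists y1.
apply: ge_ereal_sup => _ [[y1' y2'] Yy' <-].
have amax_psi y : Y1 D y -> enorm (y - y1) <= 1 -> (psi D xi x1 y <= psi D xi x1 y1)%E.
  by move=> Yy1 _; exact: stage1_argmax_psi.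
have solxy := second_stage_solution_sol Xx Yy.
exact: (Theta_le_local_max Xx Yy solxy ltr01 amax_psi Yy').
Qed.

(** * Equivalence of the minimax points *)

Section equivalence.
Variables (x1 : 'cV[R]_n1) (x2 : 'cV[R]_l -> 'cV[R]_n2).
Variables (y1 : 'cV[R]_m1) (y2 : 'cV[R]_l -> 'cV[R]_m2).
Hypothesis sol : second_stage_solution D xi x1 y1 x2 y2.

Lemma TS_global_INT_global :
  TS_global_minimax D xi x1 y1 <-> INT_global_minimax D xi p (x1, x2) (y1, y2).
Proof.
split=> [[Xx Yy ts]|[[_ /= Xx _] [_ /= Yy _] int]].
- split; [exact: solution_bX sol|exact: solution_bY sol|].
  move=> x [y1' y2'] Xx' Yy'; rewrite /minimax_ineqs (Theta_solution Xx Yy sol); split.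
    have locmax y : Y1 D y -> enorm (y - y1) <= 1 -> (psi D xi x1 y <= psi D xi x1 y1)%E.
      by move=> Yy1 _; exact: (ts x1 y Xx Yy1).1.
    exact: (Theta_le_local_max Xx Yy sol ltr01 locmax Yy').
  have [_ X1x _] := Xx'; apply: le_trans (ts x.1 y1 X1x Yy).2 _.
  exact: sup_psi_le_sup_Theta.
- split; [exact: Xx|exact: Yy|move=> x y X1x Y1y].
  have /eqP := Theta_solution Xx Yy sol; rewrite eq_le => /andP[Th_le Th_ge].
  have Xx2 := solution_bX Xx Yy sol; have Yy2 := solution_bY Xx Yy sol; split.
    have solxy := second_stage_solution_sol Xx Y1y.
    apply: (le_trans (psi_le_Theta Xx Y1y Xx2)); apply: le_trans Th_le.
    exact: (int _ _ Xx2 (solution_bY Xx Y1y solxy)).1.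
  have [ys' amax] := stage1_argmax_exists X1x (ex_intro _ _ Yy).
  have solxy := second_stage_solution_sol X1x amax.1.
  apply: le_trans (sup_Theta_le_sup_psi X1x amax); apply: (le_trans Th_ge).
  exact: (int _ _ (solution_bX X1x amax.1 solxy) Yy2).2.
Qed.

(** Moving the first stage variables slightly moves the solutions uniformly little, hence little in
    L^p; half of [e] goes to each component. *)
Lemma INT_dist_sol (e : R) : X1 D x1 -> Y1 D y1 -> 0 < e -> exists2 r : R, 0 < r &
  forall x1' y1', X1 D x1' -> Y1 D y1' -> `|x1' - x1| < r -> `|y1' - y1| < r ->
    (INT_dist xi p (x1', xsol x1' y1') (x1, x2) <= e%:E)%E /\
    (INT_dist xi p (y1', ysol x1' y1') (y1, y2) <= e%:E)%E.
Proof.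
move=> Xx Yy e0; have [mx my _] := sol.
pose N : R := n1%:R + m1%:R + n2%:R + m2%:R + 1.
have N0 : 0 < N by rewrite ltr_wpDl// !addr_ge0.
pose k := e / (2 * N); have k0 : 0 < k by rewrite divr_gt0// mulr_gt0.
have enorm_small n (u : 'cV[R]_n) : n%:R <= N -> `|u| < k -> enorm u <= e / 2.
  move=> nN uk; apply: (le_trans (enorm_le_normm _)).
  have -> : e / 2 = N * k by rewrite /k; field; exact: lt0r_neq0.
  by rewrite ler_pM// ltW.
have p1 : 0 <= (n1%:R : R) by []. have p2 : 0 <= (m1%:R : R) by [].
have p3 : 0 <= (n2%:R : R) by []. have p4 : 0 <= (m2%:R : R) by [].
have [r r0 Hr] := sol_uniformly_continuous k0.
exists (Num.min r k); first by rewrite lt_min r0.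
move=> x1' y1' Xx' Yy'; rewrite !lt_min => /andP[xr xk] /andP[yr yk].
have ee : (e%:E = (e / 2)%:E + (e / 2)%:E :> \bar R)%E.
  by rewrite -EFinD; congr EFin; field.
have aeE := second_stage_solutionE Xx Yy sol.
have e20 : 0 <= e / 2 by rewrite divr_ge0// ltW.
rewrite ee; split; apply: leeD.
- by rewrite lee_fin; apply: enorm_small => //; rewrite /N; lra.
- apply: Lp_dist_le => //; first exact: measurable_xsol.
  apply: (ae_imply _ aeE) => z [_ [/= -> _]]; apply: enorm_small; first by rewrite /N; lra.
  exact: (Hr _ _ _ _ z Xx' Yy' Xx Yy xr yr).1.
- by rewrite lee_fin; apply: enorm_small => //; rewrite /N; lra.
- apply: Lp_dist_le => //; first exact: measurable_ysol.
  apply: (ae_imply _ aeE) => z [_ [_ /= ->]]; apply: enorm_small; first by rewrite /N; lra.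
  exact: (Hr _ _ _ _ z Xx' Yy' Xx Yy xr yr).2.
Qed.

Lemma TS_local_INT_local :
  TS_local_minimax D xi x1 y1 <-> INT_local_minimax D xi p (x1, x2) (y1, y2).
Proof.
split=> [[Xx Yy [d0 d00 ts]]|[[_ /= Xx _] [_ /= Yy _] [d0 d00 int]]].
- split; [exact: solution_bX sol|exact: solution_bY sol|exists d0 => //].
  (* The proximity of [y] is dropped: the inner inequality is obtained on all of [bY]. *)
  move=> e /andP[e0 ed] x [y1' y2'] Xx' Yy' xe _.
  rewrite /minimax_ineqs (Theta_solution Xx Yy sol); split.
    have d0d : 0 < d0 <= d0 by rewrite d00 lexx.
    have locmax y : Y1 D y -> enorm (y - y1) <= d0 -> (psi D xi x1 y <= psi D xi x1 y1)%E.
      move=> Yy1 yd; apply: (ts d0 d0d x1 y Xx Yy1 _ _).1; rewrite lee_fin//.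
      by rewrite subrr enorm0 ltW.
    exact: (Theta_le_local_max Xx Yy sol d00 locmax Yy').
  have [_ X1x _] := Xx'.
  have xe' : ((enorm (x.1 - x1))%:E <= e%:E)%E.
    apply: le_trans xe; rewrite /INT_dist leeDl//; exact: Lnorm_ge0.
  have ed' : 0 < e <= d0 by rewrite e0.
  apply: le_trans (ts e ed' x.1 y1 X1x Yy xe' _).2 (sup_psi_le_sup_Theta Xx').
  by rewrite lee_fin subrr enorm0 ltW.
- have /eqP := Theta_solution Xx Yy sol; rewrite eq_le => /andP[Th_le Th_ge].
  have [r r0 Hr] := INT_dist_sol Xx Yy d00.
  have d0d : 0 < d0 <= d0 by rewrite d00 lexx.
  have Xx2 := solution_bX Xx Yy sol.
  have xx0 : `|x1 - x1| < r by rewrite subrr normr0.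
  have max_r y : Y1 D y -> `|y - y1| < r -> (psi D xi x1 y <= psi D xi x1 y1)%E.
    move=> Y1y yr; have solxy := second_stage_solution_sol Xx Y1y.
    apply: (le_trans (psi_le_Theta Xx Y1y Xx2)); apply: le_trans Th_le.
    have [h1 h2] := Hr _ _ Xx Y1y xx0 yr.
    exact: (int d0 d0d _ _ (solution_bX Xx Y1y solxy) (solution_bY Xx Y1y solxy) h1 h2).1.
  have r2 : 0 < r / 2 by rewrite divr_gt0.
  (* Passing through [Theta] upgrades the local maximum of [psi] at [x1] to one over all of [Y1]. *)
  have amax : stage1_argmax x1 y1.
    apply: (stage1_argmaxP Xx Yy) => y Y1y; apply: (le_trans (psi_le_Theta Xx Y1y Xx2)).
    have locmax y' : Y1 D y' -> enorm (y' - y1) <= r / 2 ->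
        (psi D xi x1 y' <= psi D xi x1 y1)%E.
      move=> Y1y' yr; apply: max_r; first by []; apply: le_lt_trans (normm_le_enorm _) _.
      by apply: le_lt_trans yr _; lra.
    have Yy' := solution_bY Xx Y1y (second_stage_solution_sol Xx Y1y).
    exact: (Theta_le_local_max Xx Yy sol r2 locmax Yy').
  have [q q0 Hq] := stage1_argmax_continuous Xx amax r0.
  (* The bound by [r] keeps [x] and [y] close enough for [Hr] and [max_r]; the bound by [q] brings
     the maximizer at [x] within [r] of [y1]. *)
  split; [exact: Xx|exact: Yy|]; exists (Num.min (r / 2) (q / 2)).
    by rewrite lt_min r2 divr_gt0.
  move=> e /andP[e0]; rewrite le_min => /andP[er eq] x y X1x Y1y.
  rewrite !lee_fin => xe ye.
  have xr : `|x - x1| < r.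
    by apply: le_lt_trans (le_trans (normm_le_enorm _) xe) _; lra.
  have xq : `|x1 - x| < q.
    by rewrite distrC; apply: le_lt_trans (le_trans (normm_le_enorm _) xe) _; lra.
  split.
    apply: max_r; first by []; apply: le_lt_trans (le_trans (normm_le_enorm _) ye) _; lra.
  have [y' amax'] := stage1_argmax_exists X1x (ex_intro _ _ Yy).
  have Y1y' := amax'.1; have solxy := second_stage_solution_sol X1x Y1y'.
  have yr : `|y' - y1| < r by rewrite distrC; exact: (Hq x y').
  have [h1 h2] := Hr _ _ X1x Y1y' xr yr.
  apply: le_trans (sup_Theta_le_sup_psi X1x amax'); apply: (le_trans Th_ge).
  (* The radius here is [d0] rather than [e]: the solution at [(x, y')] is only known to be
     [d0]-close. *)
  exact: (int d0 d0d _ _ (solution_bX X1x Y1y' solxy) (solution_bY X1x Y1y' solxy) h1 h2).2.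
Qed.

End equivalence.

End two_stage.

(** The first clause guarantees that the equivalences are not vacuous: a measurable second stage
    solution exists at every point of [X1] times [Y1]. *)
Theorem proposition3p4 (R : realType) (n1 m1 n2 m2 l l2 s2 : nat)
    (D : two_stage_data R n1 m1 n2 m2 l l2 s2)
    (d : measure_display) (Omega : measurableType d) (P : probability Omega R)
    (xi : {RV P >-> borelV R l}) (sigma p : R) :
  0 < sigma -> 1 <= p ->
  standing_assumptions D xi sigma -> assumptionA D xi -> assumptionB D xi ->
  (forall (x1 : 'cV[R]_n1) (y1 : 'cV[R]_m1), X1 D x1 -> Y1 D y1 ->
    exists (x2 : 'cV[R]_l -> 'cV[R]_n2) (y2 : 'cV[R]_l -> 'cV[R]_m2),
      second_stage_solution D xi x1 y1 x2 y2) /\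
  (forall (x1 : 'cV[R]_n1) (x2 : 'cV[R]_l -> 'cV[R]_n2)
          (y1 : 'cV[R]_m1) (y2 : 'cV[R]_l -> 'cV[R]_m2),
    second_stage_solution D xi x1 y1 x2 y2 ->
    (TS_global_minimax D xi x1 y1 <->
     INT_global_minimax D xi p (x1, x2) (y1, y2))) /\
  (forall (x1 : 'cV[R]_n1) (x2 : 'cV[R]_l -> 'cV[R]_n2)
          (y1 : 'cV[R]_m1) (y2 : 'cV[R]_l -> 'cV[R]_m2),
    second_stage_solution D xi x1 y1 x2 y2 ->
    (TS_local_minimax D xi x1 y1 <->
     INT_local_minimax D xi p (x1, x2) (y1, y2))).
Proof.
move=> sigma_gt0 p_ge1 standing assA assB.
have [xs [ys [sad cxs cys]]] := second_stage_map_exists sigma_gt0 standing assA assB.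
split; last split.
- move=> x1 y1 Xx Yy; exists (xsol xi xs x1 y1), (ysol xi ys x1 y1).
  exact: (second_stage_solution_sol sigma_gt0 standing assA assB sad cxs cys Xx Yy).
- move=> x1 x2 y1 y2 sol.
  exact: (TS_global_INT_global sigma_gt0 p_ge1 standing assA assB sad cxs cys sol).
- move=> x1 x2 y1 y2 sol.
  exact: (TS_local_INT_local sigma_gt0 p_ge1 standing assA assB sad cxs cys sol).
Qed.
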